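(* Let $F$ be a free group, let $r_1,r_2\in F$ be words, and let $R_i=\langle r_i\rangle^F$ be the normal closure of $r_i$ in $F$, $i=1,2$. Then the group $$\frac{R_1\cap R_2}{[R_1,R_2]}$$ is a free abelian group.
   Context: $[R_1,R_2]$ is the subgroup generated by all commutators of elements of $R_1$ with elements of $R_2$. *)

(* Defs.v *)
From HB Require Import structures.
From mathcomp Require Import all_boot all_algebra generic_quotient.
From mathcomp Require Import boolp classical_sets.
From mathcomp Require Import freeg.

Set Implicit Arguments.
Unset Strict Implicit.
Unset Printing Implicit Defensive.

Local Open Scope group_scope.
Local Open Scope classical_set_scope.

Section Subgroups.
Variable G : groupType.
Implicit Types A B H N : set G.

Definition subgroup : set (set G) := [set H | group_closed [in H]].

Definition normal_subgroup : set (set G) :=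
  [set N | subgroup N /\ forall x y : G, N x -> N (x ^ y)].

Definition generated A : set G := smallest subgroup A.

Definition normal_closure (r : G) : set G := smallest normal_subgroup [set r].

(* [~ x, y] is x^-1 * y^-1 * x * y. *)
Definition commutator A B : set G :=
  generated [set z | exists x y : G, [/\ A x, B y & z = [~ x, y]]].

Lemma subgroupP H :
  subgroup H <-> H 1 /\ forall x y : G, H x -> H y -> H (x / y).
Proof.
split=> [[h1 hF]|[h1 hF]].
  split=> [|x y hx hy]; first by move: h1; rewrite inE.
  by have := hF x y; rewrite !inE; apply.
by split=> [|x y]; rewrite !inE //; apply: hF.
Qed.

Lemma subgroupV H x : subgroup H -> H x -> H x^-1.
Proof. by move=> /subgroupP[h1 hF] hx; rewrite -[x^-1]mul1g; apply: hF. Qed.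

Lemma subgroupM H x y : subgroup H -> H x -> H y -> H (x * y).
Proof.
move=> sH hx hy; rewrite -[y]invgK; have /subgroupP[_] := sH; apply=> //.
exact: subgroupV.
Qed.

Lemma subgroup_generated A : subgroup (generated A).
Proof.
apply/subgroupP; split=> [|x y hx hy] H [sH AH]; have /subgroupP[h1 hF] := sH.
  by [].
by apply: hF; [apply: hx|apply: hy].
Qed.

Lemma normal_normal_closure r : normal_subgroup (normal_closure r).
Proof.
split=> [|x y hx N [nN rN]]; last by apply: nN.2; apply: hx.
apply/subgroupP; split=> [|x y hx hy] N [nN rN];
  have /subgroupP[h1 hF] := nN.1 => //.
by apply: hF; [apply: hx|apply: hy].
Qed.

Lemma subgroupI A B : subgroup A -> subgroup B -> subgroup (A `&` B).
Proof.
move=> /subgroupP[a1 aF] /subgroupP[b1 bF]; apply/subgroupP; split=> //.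
by move=> x y [ax bx] [ay by_]; split; [apply: aF|apply: bF].
Qed.

Lemma normal_commutator A B :
  normal_subgroup A -> normal_subgroup B -> normal_subgroup (commutator A B).
Proof.
move=> [sA nA] [sB nB]; split=> [|x y hx]; first exact: subgroup_generated.
have sC := subgroup_generated [set z | exists x y, [/\ A x, B y & z = [~ x, y]]].
have /subgroupP[c1 cF] := sC.
apply: (hx [set u | commutator A B (u ^ y)]); split.
  apply/subgroupP; split=> [|u v /= hu hv]; first by rewrite /= conj1g.
  by rewrite conjMg conjVg; apply: cF.
move=> _ [a [b [ha hb ->]]] /=; rewrite conjRg => H [sH]; apply.
by exists (a ^ y), (b ^ y); split=> //; [apply: nA|apply: nB].
Qed.

Lemma commutator_subI A B :
  normal_subgroup A -> normal_subgroup B -> commutator A B `<=` A `&` B.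
Proof.
move=> [sA nA] [sB nB] z; apply; split; first exact: subgroupI.
move=> _ [a [b [ha hb ->]]]; split.
  by apply: subgroupM => //; [exact: subgroupV|exact: nA].
rewrite commgEr; apply: subgroupM => //; apply: nB; exact: subgroupV.
Qed.

End Subgroups.

Section SubgroupType.
Variables (G : groupType) (H : set G).

Record subgroup_type (sH : subgroup H) : Type :=
  SubgroupElt { subgroup_val : G; _ : subgroup_val \in H }.

Variable sH : subgroup H.
HB.instance Definition _ := [isSub for @subgroup_val sH].
HB.instance Definition _ := [Choice of subgroup_type sH by <:].
HB.instance Definition _ :=
  SubChoice_isSubGroup.Build G [in H] (subgroup_type sH) sH.

End SubgroupType.

Section Quotient.
Variables (G : groupType) (N : set G).
Hypothesis nN : normal_subgroup N.

Definition coset_rel (x y : G) : bool := x^-1 * y \in N.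

Let nM x y : N x -> N y -> N (x * y). Proof. exact: subgroupM nN.1. Qed.
Let nV x : N x -> N x^-1. Proof. exact: subgroupV nN.1. Qed.
Let nJ x y : N x -> N (x ^ y). Proof. exact: nN.2. Qed.

Lemma coset_rel_refl : reflexive coset_rel.
Proof. by move=> x; rewrite /coset_rel mulVg; have [] := nN.1. Qed.

Lemma coset_rel_sym : symmetric coset_rel.
Proof.
by move=> x y; apply/idP/idP; rewrite /coset_rel !inE => /nV;
  rewrite invgM invgK.
Qed.

Lemma coset_rel_trans : transitive coset_rel.
Proof.
move=> y x z; rewrite /coset_rel !inE => h1 h2.
by have := nM h1 h2; rewrite -mulgA mulVKg.
Qed.

Local Open Scope quotient_scope.

Definition coset_equiv : equiv_rel G :=
  EquivRel coset_rel coset_rel_refl coset_rel_sym coset_rel_trans.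

Definition quotient : Type := {eq_quot coset_equiv}.
HB.instance Definition _ := Choice.on quotient.
HB.instance Definition _ : EqQuotient G coset_equiv quotient :=
  EqQuotient.on quotient.

Local Notation pi := (\pi_quotient).

Definition quotient_one : quotient := pi 1.
Definition quotient_mul (u v : quotient) : quotient := pi (repr u * repr v).
Definition quotient_inv (u : quotient) : quotient := pi (repr u)^-1.

Lemma eq_pi x y : pi x = pi y <-> N (x^-1 * y).
Proof.
split=> [/eqmodP|h]; first by rewrite /= /coset_rel inE.
by apply/eqmodP; rewrite /= /coset_rel inE.
Qed.

Lemma repr_pi x : N ((repr (pi x))^-1 * x).
Proof. by apply/eq_pi; rewrite reprK. Qed.

(* The projection is multiplicative: the operations do not depend on the
   representatives picked by repr. *)
Lemma pi_mul x y : quotient_mul (pi x) (pi y) = pi (x * y).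
Proof.
apply/eq_pi; set a := repr _; set b := repr _.
have ha : N (a^-1 * x) := repr_pi x; have hb : N (b^-1 * y) := repr_pi y.
have -> : (a * b)^-1 * (x * y) = (a^-1 * x) ^ b * (b^-1 * y).
  by rewrite conjgE invgM -!mulgA mulVKg.
by apply: nM => //; apply: nJ.
Qed.

Lemma pi_inv x : quotient_inv (pi x) = pi x^-1.
Proof.
apply/eq_pi; set a := repr _; have ha : N (a^-1 * x) := repr_pi x.
have -> : (a^-1)^-1 * x^-1 = ((a^-1 * x)^-1) ^ (a^-1).
  by rewrite conjgE !invgM !invgK -!mulgA mulgV mulg1.
by apply: nJ; apply: nV.
Qed.

Lemma quotient_mulA : associative quotient_mul.
Proof.
move=> u v w; rewrite -[u]reprK -[v]reprK -[w]reprK.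
move: (repr u) (repr v) (repr w) => x y z.
by rewrite (pi_mul y z) (pi_mul x y) !pi_mul mulgA.
Qed.

Lemma quotient_mul1 : left_id quotient_one quotient_mul.
Proof. by move=> u; rewrite -[u]reprK; move: (repr u) => x; rewrite pi_mul mul1g. Qed.

Lemma quotient_1mul : right_id quotient_one quotient_mul.
Proof. by move=> u; rewrite -[u]reprK; move: (repr u) => x; rewrite pi_mul mulg1. Qed.

Lemma quotient_mulV : left_inverse quotient_one quotient_inv quotient_mul.
Proof. move=> u; rewrite -[u]reprK; move: (repr u) => x.
by rewrite pi_inv pi_mul mulVg. Qed.

Lemma quotient_Vmul : right_inverse quotient_one quotient_inv quotient_mul.
Proof. move=> u; rewrite -[u]reprK; move: (repr u) => x.
by rewrite pi_inv pi_mul mulgV. Qed.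

HB.instance Definition _ := isGroup.Build quotient
  quotient_mulA quotient_mul1 quotient_1mul quotient_mulV quotient_Vmul.

End Quotient.

Section Subquotient.
Variables (G : groupType) (A N : set G).
Hypotheses (sA : subgroup A) (nN : normal_subgroup N).

Lemma normal_in_subgroup_type :
  normal_subgroup [set x : subgroup_type sA | N (val x)].
Proof.
have [/subgroupP[n1 nF] nJ] := nN; split=> [|x y]; last exact: nJ.
by apply/subgroupP; split=> [|x y]; [exact: n1|exact: nF].
Qed.

(* The group A / N, for N normal in G and contained in the subgroup A: N is
   seen inside the group A through the inclusion. *)
Definition subquotient (sNA : N `<=` A) : groupType :=
  quotient normal_in_subgroup_type.

End Subquotient.

(* B is a basis of F: every map from B to a group extends uniquely to a
   morphism. Maps on B are given by maps on F, of which only the values on B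
   matter. *)
Definition free_basis (F : groupType) (B : set F) : Prop :=
  forall (G : groupType) (f : F -> G),
    exists2 phi : {multiplicative F -> G}, {in B, phi =1 f} &
      forall psi : {multiplicative F -> G}, {in B, psi =1 f} -> psi =1 phi.

Definition free_group (F : groupType) : Prop :=
  exists B : set F, free_basis B.

(* A is isomorphic to the group {freeg X} of finitely supported formal sums
   of elements of some X with integer coefficients. *)
Definition free_abelian_group (A : groupType) : Prop :=
  exists (X : choiceType) (phi : A -> {freeg X}),
    bijective phi /\ {morph phi : x y / x * y >-> (x + y)%R}.

(* Main.v *)
(** Write S = R1 R2. If R1 and R2 are arbitrary normal subgroups of the free group F,
    then [R1,S] ∩ [R2,S] = [R1,R2]: modulo [R1,R2] an element of the intersection lies in
    [R1,R1] ∩ [R2,S]; since S is projective there is a morphism from S to R1 that is the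
    identity modulo R2, and modulo [R1, R1 ∩ R2] it fixes [R1,R1] and kills [R2,S].
    So (R1 ∩ R2)/[R1,R2] embeds in R1/[R1,S] × R2/[R2,S]. For the normal closure R of one
    word, R/[R,S] is free abelian: this is Lyndon's identity theorem. Subgroups of free
    abelian groups are free abelian.

    Lyndon's theorem is proved by Howie's tower method. The finitely many vertices of the
    Cayley tree of F that an identity visits carry a finest total preorder compatible with
    the edges and with the relators (the tower). Every rational cocycle of the quotient
    2-complex is a coboundary, for otherwise it lifts to the tree and refines the preorder.
    The quotient is staggered along one letter of the relator, and then each 2-cell runs
    exactly once through its top edge; as no lower 2-cell meets that edge, the coefficients
    of the identity vanish one after the other from the top. *)

Require Import Defs.
From HB Require Import structures.
From mathcomp Require Import all_boot all_order all_algebra generic_quotient.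
From mathcomp Require Import boolp classical_sets wochoice.
From mathcomp Require Import freeg.
From mathcomp Require Import lra zify.

Set Implicit Arguments.
Unset Strict Implicit.
Unset Printing Implicit Defensive.

Import Order.TTheory GRing.Theory Num.Theory.
Local Open Scope group_scope.
Local Open Scope classical_set_scope.

(** * Free groups *)

Section Bijections.
Variable T : Type.

(** Freeness of [F] is used only through its universal property, in the form of [basis_ind] and
    [free_recursion]: every function on the edges of the Cayley graph is the coboundary of a
    function on the vertices. This is the tree property in cohomological form, and no normal form of
    words is needed.

    The rationals serve twice. Their order lets a potential refine a preorder. And they absorb
    proper powers: for r conjugate to sigma^m the cells are attached along the root sigma, which
    produces a factor m that is cancelled at the end. Only q and q sigma^m are glued; that q and q
    sigma become equivalent is forced by the order, while a mere equivalence relation would not give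
    it.

    Lyndon's theorem is needed with S in place of R. The group R/[R,S] consists of the
    S-coinvariants of R/[R,R], a module in which F permutes the conjugates of r; coinvariants of a
    permutation module are again free abelian. The proof works with these coinvariants directly,
    testing identities against functions invariant under S. *)

Record bijection := Bijection {
  bij_fun : T -> T; bij_inv : T -> T;
  bij_funK : cancel bij_fun bij_inv; bij_invK : cancel bij_inv bij_fun }.

HB.instance Definition _ := gen_eqMixin bijection.
HB.instance Definition _ := gen_choiceMixin bijection.

Lemma bijection_ext (a b : bijection) : bij_fun a =1 bij_fun b -> a = b.
Proof.
case: a b => [f f' fK f'K] [g g' gK g'K] /= fg.
have {}fg : f = g by apply: funext.
subst g; have f'g' : f' = g' by apply: funext => x; rewrite -{1}[x]g'K fK.
by subst g'; congr Bijection; apply: Prop_irrelevance.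
Qed.

Definition bij_one := @Bijection id id (fun=> erefl) (fun=> erefl).
(* left-to-right composition: bijections act on the right *)
Definition bij_mul (a b : bijection) : bijection :=
  Bijection (can_comp (bij_funK b) (bij_funK a))
    (can_comp (bij_invK a) (bij_invK b)).
Definition bij_opp (a : bijection) : bijection :=
  Bijection (bij_invK a) (bij_funK a).

Lemma bij_mulA : associative bij_mul.
Proof. by move=> a b c; apply: bijection_ext. Qed.
Lemma bij_mul1g : left_id bij_one bij_mul.
Proof. by move=> a; apply: bijection_ext. Qed.
Lemma bij_mulg1 : right_id bij_one bij_mul.
Proof. by move=> a; apply: bijection_ext. Qed.
Lemma bij_mulVg : left_inverse bij_one bij_opp bij_mul.
Proof. by move=> a; apply: bijection_ext => x; apply: bij_invK. Qed.
Lemma bij_mulgV : right_inverse bij_one bij_opp bij_mul.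
Proof. by move=> a; apply: bijection_ext => x; apply: bij_funK. Qed.

HB.instance Definition _ := isGroup.Build bijection
  bij_mulA bij_mul1g bij_mulg1 bij_mulVg bij_mulgV.

End Bijections.

Section FreeBasis.
Variables (F : groupType) (B : set F).
Hypothesis hB : free_basis B.

(** The morphism from [F] to [H] that extends the inclusion of [B], followed by the inclusion of
    [H], fixes [B]; by uniqueness it is the identity. The default 1 of [insubd] is never taken on
    [B]. *)
Lemma subgroup_basis_full (H : set F) : subgroup H -> B `<=` H -> forall f, H f.
Proof.
move=> sH BH.
have [phi phiB _] := hB (fun x => insubd (1 : subgroup_type sH) x).
have [psi _ psi_uniq] := hB (id : F -> F).
have e1 : (val \o phi : F -> F) =1 psi.
  apply: (psi_uniq (val \o phi : {multiplicative F -> F})) => x xB /=.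
  by rewrite phiB // insubdK //; apply/mem_set/BH; apply: set_mem.
have e2 : (idfun : F -> F) =1 psi by apply: (psi_uniq (idfun : {multiplicative F -> F})).
by move=> f; have := e2 f; rewrite -e1 /= => {1}->; apply/set_mem/valP.
Qed.

Lemma basis_ind (P : F -> Prop) : P 1 ->
  (forall f x, B x -> P f -> P (f * x)) ->
  (forall f x, B x -> P f -> P (f * x^-1)) -> forall f, P f.
Proof.
move=> P1 PM PV f.
(* [P] itself need not be a subgroup; the elements that preserve it under right translation,
   together with their inverses, form one. *)
pose H : set F := [set f | forall g, P g -> P (g * f) /\ P (g * f^-1)].
suff /(_ f)/(_ 1 P1)[] : forall f, H f by rewrite mul1g.
apply: subgroup_basis_full => [|x Bx g Pg]; last by split; [apply: PM|apply: PV].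
apply/subgroupP; split=> [g Pg|x y hx hy g Pg]; first by rewrite invg1 mulg1.
rewrite invgM invgK !mulgA; split.
  by apply: (hy _ _).2; apply: (hx _ _).1.
by apply: (hx _ _).2; apply: (hy _ _).1.
Qed.

(** Each [x] acts on [F * A] by sending (f, a) to (f x, s f x a). The universal property, applied to
    the group of bijections, extends this to a right action of [F], and [h f] is the second
    coordinate of (1, a0) moved by [f]. With translations of the rationals for [s], this integrates
    an arbitrary cochain on the Cayley graph. *)
Lemma free_recursion (A : Type) (a0 : A) (s s' : F -> F -> A -> A) :
  (forall f x, cancel (s f x) (s' f x)) -> (forall f x, cancel (s' f x) (s f x)) ->
  exists2 h : F -> A, h 1 = a0 & forall f x, B x -> h (f * x) = s f x (h f).
Proof.
move=> sK s'K.
pose step x (t : F * A) := (t.1 * x, s t.1 x t.2).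
pose step' x (t : F * A) := (t.1 * x^-1, s' (t.1 * x^-1) x t.2).
have stepK x : cancel (step x) (step' x).
  by case=> f a; rewrite /step /step' /= mulgK sK.
have step'K x : cancel (step' x) (step x).
  by case=> f a; rewrite /step /step' /= mulgVK s'K.
have [phi phiB _] := hB (fun x => Bijection (stepK x) (step'K x)).
have phi_1 : phi 1 = 1 by apply: (mulgI (phi 1)); rewrite -gmulfM !mulg1.
have phiV x : phi x^-1 = (phi x)^-1.
  by apply: (mulgI (phi x)); rewrite -gmulfM !mulgV.
have phi1 f : (bij_fun (phi f) (1, a0)).1 = f.
  elim/basis_ind: f => [|f x Bx IH|f x Bx IH].
  - by rewrite phi_1.
  - by rewrite gmulfM (phiB _ (mem_set Bx)) -[LHS]/((bij_fun (phi f) (1, a0)).1 * x) IH.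
  - rewrite gmulfM phiV (phiB _ (mem_set Bx)).
    by rewrite -[LHS]/((bij_fun (phi f) (1, a0)).1 * x^-1) IH.
exists (fun f => (bij_fun (phi f) (1, a0)).2) => [|f x Bx]; first by rewrite phi_1.
rewrite gmulfM (phiB _ (mem_set Bx)) -{2}[f]phi1.
by [].
Qed.

End FreeBasis.

(** * Staggered 2-complexes *)

Lemma pairwise_rev (T : Type) (r : rel T) (s : seq T) :
  pairwise r (rev s) = pairwise (fun x y => r y x) s.
Proof. by elim: s => //= x s IH; rewrite rev_cons pairwise_rcons all_rev IH. Qed.

Section StaggeredGraph.
Local Open Scope ring_scope.
Variables (V E : eqType) (src tgt : E -> V).

Local Notation dart := (E * bool)%type.
Local Notation cell := (seq dart * E * E)%type.
Implicit Types (o : dart) (p : seq dart) (A : pred E) (c : E -> rat).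
Implicit Types (d : cell) (l : seq cell).

(* a dart (e, b) is the edge e crossed forwards if b, backwards otherwise *)
Definition osrc o := if o.2 then src o.1 else tgt o.1.
Definition otgt o := if o.2 then tgt o.1 else src o.1.
Definition orev o : dart := (o.1, ~~ o.2).
Definition adj o o' := (otgt o == osrc o') && (o' != orev o).
Definition walk_in A p := all (fun o => A o.1) p.
Definition wsum c p := \sum_(o <- p) (if o.2 then c o.1 else - c o.1).
Definition potential A c (h : V -> rat) :=
  forall e, A e -> h (tgt e) - h (src e) = c e.
Definition forest A := forall o p,
  path adj o p -> walk_in A (o :: p) -> otgt (last o p) != osrc o.

(* A 2-cell is its boundary with two marked edges: those of the boundary that are
   highest and lowest for the order along which the complex is staggered. *)
Definition bd d := d.1.1.
Definition hi d := d.1.2.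
Definition lo d := d.2.

(** Here [d] lies below [d']. Constraining only the top of the higher cell and the bottom of the
    lower one spares an order on the edges. *)
Definition staggered d d' :=
  (hi d' \notin unzip1 (bd d)) && (lo d \notin unzip1 (bd d')).
Definition cellular A d :=
  [&& cycle adj (bd d), walk_in A (bd d), hi d \in unzip1 (bd d)
    & lo d \in unzip1 (bd d)].
(* vanishing of the first rational cohomology of each component of the subcomplex with
   edges A and cells l *)
Definition acyclic A l := forall c,
  (forall d, d \in l -> wsum c (bd d) = 0) -> exists h, potential A c h.
Definition without A (s : seq E) : pred E := fun e => A e && (e \notin s).

Lemma wsum_cons c o p :
  wsum c (o :: p) = (if o.2 then c o.1 else - c o.1) + wsum c p.
Proof. exact: big_cons. Qed.

Lemma wsum_cat c p q : wsum c (p ++ q) = wsum c p + wsum c q.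
Proof. exact: big_cat. Qed.

Lemma eq_wsum c c' p :
  (forall o, o \in p -> c o.1 = c' o.1) -> wsum c p = wsum c' p.
Proof. by move=> cc; apply: eq_big_seq => o /cc ->. Qed.

Lemma wsum_lin (x y : rat) c c' p :
  wsum (fun e => x * c e + y * c' e) p = x * wsum c p + y * wsum c' p.
Proof.
rewrite /wsum !mulr_sumr -big_split; apply: eq_bigr => o _.
by case: o.2 => //=; lra.
Qed.

Lemma wsum0 c p : (forall o, o \in p -> c o.1 = 0) -> wsum c p = 0.
Proof.
by move=> c0; apply: big1_seq => o /andP[_ /c0 ->]; case: ifP; rewrite ?oppr0.
Qed.

Lemma wsum_walk A c h o p : potential A c h -> path adj o p ->
  walk_in A (o :: p) -> wsum c (o :: p) = h (otgt (last o p)) - h (osrc o).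
Proof.
move=> ch; elim: p o => [|o' p IH] o.
  move=> _ /andP[Ao _]; rewrite wsum_cons /wsum big_nil addr0 /= -(ch _ Ao).
  by rewrite /otgt /osrc; case: o.2; rewrite // opprB.
move=> /andP[/andP[/eqP eo' _] pp] /andP[Ao Ap].
rewrite wsum_cons IH // /= -eo' -(ch _ Ao) /otgt /osrc.
by case: o.2 => /=; lra.
Qed.

Lemma sub_forest A (B : pred E) :
  (forall e, B e -> A e) -> forest A -> forest B.
Proof. by move=> BA fA o p pp Bp; apply: fA => //; apply: sub_all Bp => ?; apply: BA. Qed.

Lemma split_edge e p : e \in unzip1 p ->
  exists p1 b p2, p = p1 ++ (e, b) :: p2 /\ e \notin unzip1 p1.
Proof.
elim: p => // -[e' b] p IH; rewrite /= inE; have [-> _|ne] := eqVneq e e'.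
  by exists [::], b, p.
move=> /= /IH[p1 [b' [p2 [-> np1]]]]; exists ((e', b) :: p1), b', p2.
by rewrite /= inE negb_or ne.
Qed.

(** Cut at the first recurrence of the edge of [o]. If it is crossed in the same direction, the walk
    from [o] up to it is closed; if in the opposite one, the part strictly between is closed, and
    nonempty because the walk is reduced. *)
Lemma repeat_closed A o p : path adj o p -> walk_in A (o :: p) ->
  o.1 \in unzip1 p -> exists o' p',
  [/\ path adj o' p', walk_in A (o' :: p'), otgt (last o' p') = osrc o'
    & (size p' < size p)%N].
Proof.
move=> pp Ap /split_edge[p1 [b [p2 [def_p np1]]]].
rewrite def_p cat_path in pp; move: pp => /andP[pp1 /andP[/andP[/eqP lp1 nb] _]].
move: Ap; rewrite def_p /walk_in /= all_cat -/(walk_in A _) => /and3P[Ao Ap1 _].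
have [bo|bo] := eqVneq b o.2.
  exists o, p1; split; rewrite ?def_p ?size_cat ?addnS ?ltnS ?leq_addr //=.
    by rewrite Ao.
  by rewrite lp1 bo; case: (o).
have eb : (o.1, b) = orev o by rewrite /orev; clear -bo; case: b (o.2) bo => [] [].
case: p1 pp1 Ap1 nb lp1 def_p {np1} => [|a q] pp1 Ap1 nb lp1 def_p.
  by rewrite eb eqxx in nb.
exists a, q; split=> //; first by case/andP: pp1.
  move: pp1 lp1 => /andP[/andP[/eqP <- _] _] /= ->.
  by rewrite eb /osrc /orev /otgt /=; case: o.2.
by rewrite size_cat /= addSn ltnS leq_addr.
Qed.

Lemma forest_uniq A o p : forest A -> path adj o p -> walk_in A (o :: p) ->
  uniq (unzip1 (o :: p)).
Proof.
move=> fA; elim: p o => // o' p IH o pp Ap.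
rewrite -[unzip1 _]/(o.1 :: unzip1 (o' :: p)) cons_uniq IH; last 2 first.
- by case/andP: pp.
- by case/andP: Ap.
rewrite andbT; apply/negP=> /(repeat_closed pp Ap)[a [q [qq Aq cl _]]].
by have := fA _ _ qq Aq; rewrite cl eqxx.
Qed.

(** In a shortest closed reduced walk the first edge does not recur, so its indicator sums to 1 or
    -1 along the walk, whereas a coboundary sums to 0. *)
Lemma acyclic_forest A : acyclic A [::] -> forest A.
Proof.
move=> hA o p; have [n] := ubnP (size p); elim: n o p => // n IH o p ltn pp Ap.
apply/eqP=> cl; case: (boolP (o.1 \in unzip1 p)) => [rp|np].
  have [o' [p' [pp' Ap' cl' lt']]] := repeat_closed pp Ap rp.
  by have := IH o' p' (leq_trans lt' ltn) pp' Ap'; rewrite cl' eqxx.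
have [//|h ch] := hA (fun e => (e == o.1)%:R).
have := wsum_walk ch pp Ap; rewrite cl subrr wsum_cons wsum0 => [|o' o'p].
  by rewrite eqxx; case: o.2 => /=; lra.
by case: eqP => // e; case/negP: np; rewrite -e map_f.
Qed.

Lemma osrc_rev o : osrc (orev o) = otgt o.
Proof. by rewrite /osrc /otgt /=; case: o.2. Qed.

Lemma otgt_rev o : otgt (orev o) = osrc o.
Proof. by rewrite /osrc /otgt /=; case: o.2. Qed.

Lemma orevK : involutive orev.
Proof. by case=> e b; rewrite /orev /= negbK. Qed.

Lemma adj_rev o o' : adj (orev o') (orev o) = adj o o'.
Proof.
by rewrite /adj osrc_rev otgt_rev eq_sym orevK [o' == _]eq_sym.
Qed.

Definition walk_from_to u v p :=
  if p is o :: p' then [&& osrc o == u, otgt (last o p') == v & path adj o p']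
  else u == v.

Lemma walk_uniq A u v p q : forest A -> walk_in A p -> walk_in A q ->
  walk_from_to u v p -> walk_from_to u v q -> p = q.
Proof.
move=> fA; elim: p u q => [|o p IH] u [|o' q] //.
- move=> _ Aq /eqP -> /and3P[/eqP ov /eqP lv qq].
  by have := fA _ _ qq Aq; rewrite lv ov eqxx.
- move=> Ap _ /and3P[/eqP ov /eqP lv pp] /eqP uv.
  by have := fA _ _ pp Ap; rewrite lv ov uv eqxx.
move=> Ap Aq /and3P[/eqP ou /eqP lp pp] /and3P[/eqP ou' /eqP lq qq].
have [eo|ne] := eqVneq o o'.
  subst o'; congr cons; move: Ap Aq => /andP[_ Ap] /andP[_ Aq].
  apply: (IH (otgt o)) => //.
  - by case: p pp lp {IH Ap} => [|a p] /=; [move=> _ ->|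
      move=> /andP[/andP[/eqP -> _] ->] ->; rewrite !eqxx].
  - by case: q qq lq {Aq} => [|a q] /=; [move=> _ ->|
      move=> /andP[/andP[/eqP -> _] ->] ->; rewrite !eqxx].
exfalso.
(* Back along the first walk, then along the second: closed, and reduced at the junction because [o]
   and [o'] differ. *)
have := fA (orev (last o p)) (rev (map orev (belast o p)) ++ o' :: q).
have pr : path adj (orev (last o p)) (rev (map orev (belast o p))).
  by rewrite -last_map -belast_map rev_path path_map; apply: sub_path pp => a b /=; rewrite adj_rev.
have hl : last (orev (last o p)) (rev (map orev (belast o p))) = orev o.
  case: (p) => [|a p'] //=; first by rewrite rev_cons last_rcons.
rewrite cat_path pr hl last_cat /= lq osrc_rev lp eqxx /= qq /adj otgt_rev ou ou' eqxx /=.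
rewrite orevK eq_sym ne => /(_ isT) nf; have /nf // : walk_in A
    (orev (last o p) :: rev (map orev (belast o p)) ++ o' :: q).
have : walk_in A (o :: p) by [].
rewrite lastI /walk_in /= all_rcons all_cat all_rev all_map => /andP[-> /= bp].
by apply/andP.
Qed.

(** Two successive crossings of [e] in opposite directions would enclose a closed reduced walk of
    the forest. So all crossings have one direction, the parts between them join the same two
    vertices and coincide by [walk_uniq], and [d] is up to rotation a power of one block;
    primitivity leaves a single block. *)
Lemma forest_unique_crossing A (e : E) (d : seq dart) :
  forest A -> cycle adj d -> (forall o, o \in d -> o.1 != e -> A o.1) ->
  e \in unzip1 d -> (forall n, (0 < n < size d)%N -> rot n d != d) ->
  exists o p n, [/\ rot n d = o :: p, o.1 = e, path adj o p, cycle adj (o :: p) &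
    walk_in A p /\ e \notin unzip1 p].
Proof.
move=> fA cd dA ed prim.
have [p1 [b [p2 [def_d _]]]] := split_edge ed.
pose o := (e, b); pose d' := o :: p2 ++ p1.
have rd : rot (size p1) d = d' by rewrite def_d rot_size_cat.
have cd' : cycle adj d' by rewrite -rd rot_cycle.
have d'A a : a \in d' -> a.1 != e -> A a.1 by rewrite -rd mem_rot; exact: dA.
have prim' n : (0 < n < size d')%N -> rot n d' != d'.
  move=> nd; have := prim n; rewrite -(size_rot (size p1)) rd => /(_ nd).
  apply: contra => /eqP; rewrite -rd => h; apply/eqP.
  by apply: (@rot_inj (size p1)); rewrite rot_rot.
suff np : e \notin unzip1 (p2 ++ p1).
  exists o, (p2 ++ p1), (size p1); split=> //.
    by move: cd'; rewrite /= rcons_path => /andP[].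
  split=> //; apply/allP=> a ap; apply: d'A; first by rewrite inE ap orbT.
  by apply: contra np => /eqP <-; apply: map_f.
pose block q := [/\ e \notin unzip1 q & walk_from_to (otgt o) (osrc o) q].
have blockA q : {subset q <= d'} -> e \notin unzip1 q -> walk_in A q.
  move=> qd' nq; apply/allP=> a aq; apply: d'A; first exact: qd'.
  by apply: contra nq => /eqP <-; apply: map_f.
(* between two consecutive crossings of e, d follows the reduced path of the forest *)
have split_blocks : forall k q, (size q < k)%N -> {subset q <= d'} ->
    path adj o q -> adj (last o q) o ->
    exists q1 m, [/\ block q1, {subset q1 <= d'} & q = q1 ++ flatten (nseq m (o :: q1))].
  elim=> // k IH q; rewrite ltnS => sq qd' pq lq.
  have [eq|nq] := boolP (e \in unzip1 q); last first.
    exists q, 0%N; split; rewrite ?cats0 //; split=> //.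
    case: q pq lq {sq qd' nq} => [_|a q] /= ; first by case/andP.
    move=> /andP[/andP[/eqP <- _] ->] /andP[/eqP -> _].
    by rewrite !eqxx.
  have [q1 [b' [q2 [def_q nq1]]]] := split_edge eq.
  move: pq lq; rewrite def_q cat_path /= last_cat /= => /and3P[pq1 aq1 pq2] lq.
  have q1d' : {subset q1 <= d'} by move=> a aq; apply: qd'; rewrite def_q mem_cat aq.
  have eb : b' = b.
    apply: contraTeq isT => bb'; have eo : (e, b') = orev o.
      by rewrite /orev /=; clear -bb'; case: b b' bb' => [] [].
    case: q1 pq1 aq1 nq1 {def_q} q1d' => [|a q1] /= pq1 aq1 nq1 q1d'.
      by move: aq1; rewrite /adj eo eqxx andbF.
    move: pq1 => /andP[aoa pq1]; have := fA _ _ pq1 (blockA _ q1d' nq1).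
    move: aq1 aoa; rewrite /adj eo osrc_rev => /andP[/eqP -> _] /andP[/eqP -> _].
    by rewrite eqxx.
  subst b'; have [||||q1' [m [bq1' q1d'' def_q2]]] := IH q2 => //.
  - by apply: leq_trans sq; rewrite def_q size_cat /= addnS ltnS leq_addl.
  - by move=> a aq; apply: qd'; rewrite def_q mem_cat inE aq !orbT.
  have bq1 : block q1.
    split=> //; case: (q1) pq1 aq1 => [_|a q'] /= ; first by case/andP.
    by move=> /andP[/andP[/eqP <- _] ->] /andP[/eqP -> _]; rewrite !eqxx.
  have eq1 : q1 = q1'.
    apply: (walk_uniq fA _ _ bq1.2 bq1'.2); first exact: blockA q1d' bq1.1.
    exact: blockA q1d'' bq1'.1.
  by exists q1, m.+1; split=> //; rewrite def_q2 -eq1.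
have [||| q1 [m [[nq1 _] _ def_q]]] := split_blocks _ (p2 ++ p1) (ltnSn _).
- by move=> a ap; rewrite inE ap orbT.
- by move: cd'; rewrite /= rcons_path => /andP[].
- by move: cd'; rewrite /= rcons_path => /andP[].
case: m def_q => [|m] def_q; first by rewrite def_q cats0.
have def_d' : d' = (o :: q1) ++ flatten (nseq m.+1 (o :: q1)).
  by rewrite /d' def_q.
have := prim' (size (o :: q1)); rewrite def_d' rot_size_cat.
have -> : flatten (nseq m.+1 (o :: q1)) ++ (o :: q1)
   = (o :: q1) ++ flatten (nseq m.+1 (o :: q1)).
  by elim: m {def_q def_d'} => [|m IH] /=; rewrite ?cats0 // -catA IH.
rewrite eqxx size_cat /= size_cat /= => h; suff: false by []; apply: h; lia.
Qed.

Lemma const_walk A c h o p : potential A c h -> path adj o p ->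
  (forall a, a \in p -> A a.1 /\ c a.1 = 0) ->
  forall a, a \in p -> h (src a.1) = h (otgt o) /\ h (tgt a.1) = h (otgt o).
Proof.
move=> ch; elim: p o => // o' p IH o /andP[/andP[/eqP eo' _] pp] Ap.
have [Ao' co'] : A o'.1 /\ c o'.1 = 0 by apply: Ap; rewrite mem_head.
have eh : h (tgt o'.1) = h (src o'.1) by apply/eqP; rewrite -subr_eq0 ch ?co'.
have ho : h (otgt o') = h (otgt o) by rewrite eo' /otgt /osrc; case: o'.2.
move=> a; rewrite inE => /predU1P[->|ap].
  by rewrite -ho /otgt; case: o'.2; rewrite eh.
rewrite -ho; apply: IH => // x xp; apply: Ap; rewrite inE xp orbT //.
Qed.

Lemma wsum_indicator e p : wsum (fun x => (x == e)%:R) p =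
  (count_mem (e, true) p)%:R - (count_mem (e, false) p)%:R.
Proof.
elim: p => [|[x b] p IH]; first by rewrite /wsum big_nil subrr.
rewrite wsum_cons IH /= !natrD /eq_op /= -/eq_op.
by case: (x == e); case: b => /=; lra.
Qed.

Definition cells A l := {in l, forall d, cellular A d} /\ pairwise staggered l.

(* If the net number of crossings of e := hi d by the boundary of d is nonzero, a cocycle
   of the smaller complex extends by a suitable value at e. If it is zero, e is a bridge
   and d makes an excursion to both sides of it, without meeting the edges lo of the other
   cells; but one of the two sides is acyclic, hence a forest after removal of these. *)
Lemma acyclic_without_top A l d :
  (forall A' l', (size l' <= size l)%N -> cells A' l' -> acyclic A' l' ->
     forest (without A' (map lo l'))) ->
  cells A (rcons l d) -> acyclic A (rcons l d) ->
  acyclic (without A [:: hi d]) l.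
Proof.
move=> IH [cellA]; rewrite pairwise_rcons => /andP[/allP std stl] hA.
pose e := hi d; pose ind x : rat := (x == e)%:R.
have ind0 p : e \notin unzip1 p -> wsum ind p = 0.
  move=> np; apply: wsum0 => o op; rewrite /ind; case: eqP => // oe.
  by case/negP: np; rewrite -oe map_f.
have hl d' : d' \in l -> e \notin unzip1 (bd d') by move=> /std/andP[].
have lol d' : d' \in l -> lo d' \notin unzip1 (bd d) by move=> /std/andP[].
have /and4P[cd dA ed _] : cellular A d by apply: cellA; rewrite mem_rcons mem_head.
have cellAl d' : d' \in l -> cellular A d'.
  by move=> d'l; apply: cellA; rewrite mem_rcons inE d'l orbT.
have in_rcons (P : cell -> Prop) :
    P d -> {in l, forall d', P d'} -> {in rcons l d, forall d', P d'}.
  by move=> Pd Pl d'; rewrite mem_rcons inE => /predU1P[->|/Pl].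
have [eps0|eps0] := eqVneq (wsum ind (bd d)) 0; last first.
  move=> c c0; pose t := - wsum c (bd d) / wsum ind (bd d).
  have [|h hc] := hA (fun x => 1 * c x + t * ind x).
    apply: in_rcons => [|d' d'l]; rewrite wsum_lin mul1r.
      by rewrite divfK // subrr.
    by rewrite c0 // ind0 ?mulr0 ?addr0 // hl.
  exists h => x /andP[Ax]; rewrite inE => xe.
  by rewrite (hc _ Ax) /ind (negbTE xe) mul1r mulr0 addr0.
exfalso.
(* With net crossing number zero the indicator of [e] is itself a cocycle. Its potential [h] rises
   by 1 along [e] and is constant along every other edge, so it separates the two sides of [e]. *)
have [|h hind] := hA ind.
  by apply: in_rcons => // d' /hl/ind0.
have he : h (tgt e) - h (src e) = 1.
  by rewrite hind /ind ?eqxx //; have /mapP[o od eo] := ed; rewrite /e eo; apply: (allP dA).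
(* Net number zero also means that [d] crosses [e] both ways. After (e, b) the next crossing of [e]
   is in the other direction, since [h] is constant in between; the part in between is the
   excursion. *)
have excursion b : exists o p, [/\ path adj o p, otgt (last o p) = osrc o &
    forall a, a \in o :: p -> [/\ a \in bd d, a.1 != e & h (src a.1) = h (otgt (e, b))]].
  have ebd : (e, b) \in bd d /\ (e, ~~ b) \in bd d.
    move: eps0; rewrite wsum_indicator => /eqP; rewrite subr_eq0 eqr_nat => /eqP ec.
    have both : (e, true) \in bd d /\ (e, false) \in bd d.
      rewrite -!has_pred1 !has_count ec; suff: (0 < count_mem (e, false) (bd d))%N by move=> ->.
      move: ed => /mapP[[x b0] od /= xe]; subst x.
      by case: b0 od => od; [rewrite -ec|]; rewrite -has_count has_pred1.
    by clear -both; case: b both => -[].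
  have [n q rd] := rot_to ebd.1.
  have cq : cycle adj ((e, b) :: q) by rewrite -rd rot_cycle.
  have qd a : a \in q -> a \in bd d by move=> aq; rewrite -(mem_rot n (bd d)) rd inE aq orbT.
  have eq : e \in unzip1 q.
    have := ebd.2; rewrite -(mem_rot n (bd d)) rd inE xpair_eqE eqxx /=.
    by case/orP => [|/(map_f fst) //]; case: (b).
  have [p1 [b' [p2 [def_q np1]]]] := split_edge eq.
  move: cq; rewrite /= def_q rcons_path cat_path /= => /andP[/and3P[pp1 lp1 _] _].
  have p1q a : a \in p1 -> a \in q by rewrite def_q mem_cat => ->.
  have ne a : a \in p1 -> a.1 != e.
    by move=> ap; apply: contra np1 => /eqP <-; apply: map_f.
  have hp1 a : a \in p1 -> h (src a.1) = h (otgt (e, b)) /\ h (tgt a.1) = h (otgt (e, b)).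
    apply: (const_walk hind) => // x xp; split; first by apply: (allP dA); apply/qd/p1q.
    by rewrite /ind (negbTE (ne _ xp)).
  have hlast : h (otgt (last (e, b) p1)) = h (otgt (e, b)).
    case/lastP: (p1) hp1 => // p a /(_ a); rewrite mem_rcons mem_head last_rcons.
    by move=> /(_ isT)[h1 h2]; rewrite {1}/otgt; case: ifP.
  have bb' : b' = ~~ b.
    move: lp1 => /andP[/eqP lp1 _]; rewrite lp1 in hlast; move: hlast he.
    by rewrite /osrc /otgt /=; case: (b); case: (b') => //= ->; rewrite subrr.
  subst b'; case: p1 pp1 lp1 {np1 hlast def_q} p1q ne hp1 => [|o p] /=.
    by rewrite /adj /orev /= eqxx andbF.
  move=> /andP[/andP[/eqP eo _] pp] /andP[/eqP lo _] pq ne hp.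
  exists o, p; split=> //; first by rewrite lo -eo; apply: (osrc_rev (e, b)).
  by move=> a ap; split; [apply/qd/pq|exact: ne|have [] := hp _ ap].
(* The false side takes all remaining values of [h], hence every edge of [A] other than [e] lies on
   exactly one side. *)
pose side b : pred E := fun x => without A [:: e] x && ((h (src x) == h (tgt e)) == b).
pose lside b := filter (fun d' => walk_in (side b) (bd d')) l.
have in_side d' : d' \in l -> exists b, walk_in (side b) (bd d').
  move=> d'l; have /and4P[cd' d'A + _] := cellAl _ d'l.
  have := hl _ d'l; case: (bd d') cd' d'A => // o p cop /allP opA nop _.
  have ne a : a \in o :: p -> a.1 != e.
    by move=> ap; apply: contra nop => /eqP <-; apply: map_f.
  exists (h (otgt o) == h (tgt e)); apply/allP => a ap.
  rewrite /side /without opA // inE ne //=.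
  have pop : path adj o (p ++ [:: o]) by move: cop; rewrite /= -cats1.
  have [||-> _] := @const_walk _ _ _ _ _ hind pop _ a => //.
    move=> x; rewrite mem_cat inE orbC -in_cons => xp.
    by rewrite /ind (negbTE (ne _ xp)); split=> //; apply: opA.
  by rewrite mem_cat inE orbC -in_cons.
have side_disj b x : side b x -> side (~~ b) x = false.
  by rewrite /side => /andP[-> /eqP ->]; case: b.
have not_acyclic b : ~ acyclic (side b) (lside b).
  move=> hb; have [o [p [pp cl hp]]] := excursion b.
  have fb : forest (without (side b) (map lo (lside b))).
    apply: IH hb; first by rewrite size_filter count_size.
    split=> [d'|]; last exact: subseq_pairwise (filter_subseq _ _) stl.
    rewrite mem_filter => /andP[bd' /cellAl/and4P[cd' _ h1 h2]].
    by apply/and4P.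
  have := fb _ _ pp; rewrite cl eqxx => nf; suff /nf: walk_in (without (side b)
    (map lo (lside b))) (o :: p) by [].
  apply/allP => a /hp[ad ae ha]; rewrite /without /side /without (allP dA) //= inE ae ha /=.
  apply/andP; split.
    rewrite /otgt; case: (b) => /=; first by rewrite eqxx.
    by apply/eqP/eqP => e0; move: he; rewrite e0 subrr.
  apply/negP => /mapP[d']; rewrite mem_filter => /andP[_ d'l] ad'.
  by have := lol _ d'l; rewrite -ad' map_f.
have bad_cocycle b : exists c, [/\ forall d', d' \in l -> wsum c (bd d') = 0,
    forall x, ~~ side b x -> c x = 0 & ~ exists g, potential (side b) c g].
  have /existsNP[c /not_implyP[c0 nc]] := not_acyclic b.
  exists (fun x => if side b x then c x else 0); split=> [d' d'l|x /negbTE ->//|].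
    have [b' sb'] := in_side _ d'l; have [eb|nb] := eqVneq b b'; last first.
      apply: wsum0 => o od; have /(_ o od) := allP sb'.
      have -> : b' = ~~ b by clear -nb; case: b b' nb => [] [].
      by move/side_disj; rewrite negbK => ->.
    subst b'; rewrite -(c0 d') ?mem_filter ?sb' //.
    by apply: eq_wsum => o /(allP sb') ->.
  by case=> g gc; apply: nc; exists g => x sx; rewrite gc // sx.
have [c1 [c1l c1s nc1]] := bad_cocycle true.
have [c2 [c2l c2s nc2]] := bad_cocycle false.
(* Each side carries a cocycle that is not a coboundary, while [d] imposes one linear condition:
   some nonzero combination of the two vanishes on [d], so it has a potential, whose restriction to
   one side gives the contradiction. *)
pose x1 := wsum c1 (bd d); pose x2 := wsum c2 (bd d).
have sA b x : side b x -> A x by move=> /andP[/andP[]].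
have [x0|x0] := eqVneq x2 0.
  have [|g gc] := hA c2; first exact: in_rcons.
  by apply: nc2; exists g => x sx; apply: gc; apply: sA sx.
have [|g gc] := hA (fun x => x2 * c1 x + (- x1) * c2 x).
  apply: in_rcons => [|d' d'l]; rewrite wsum_lin.
    by rewrite -/x1 -/x2; lra.
  by rewrite c1l // c2l // !mulr0 addr0.
apply: nc1; exists (fun v => g v / x2) => x sx.
rewrite -mulrBl gc ?(sA _ _ sx) // (c2s x); last by rewrite (side_disj true).
by rewrite mulr0 addr0 mulrC mulKf.
Qed.

(* reversing the order of the cells exchanges the roles of hi and lo *)
Let swap d : cell := (bd d, lo d, hi d).

Lemma cells_swap A l : cells A l -> cells A (rev (map swap l)).
Proof.
move=> [cl st]; split=> [d|].
  rewrite mem_rev => /mapP[d' /cl/and4P[h1 h2 h3 h4] ->].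
  by apply/and4P.
rewrite pairwise_rev pairwise_map; apply: sub_pairwise st => d d'.
by rewrite /staggered /= andbC.
Qed.

Lemma acyclic_swap A l : acyclic A l -> acyclic A (rev (map swap l)).
Proof.
move=> hl c c0; apply: hl => d dl.
by apply: (c0 (swap d)); rewrite mem_rev map_f.
Qed.

(** The two halves need each other. Removing a top edge preserves acyclicity thanks to the statement
    on bottom edges for fewer cells; the statement on bottom edges for [l] is the one on top edges
    for the reversed order. *)
Lemma staggered_forest A l : cells A l -> acyclic A l ->
  forest (without A (map hi l)) /\ forest (without A (map lo l)).
Proof.
have [n] := ubnP (size l); elim: n A l => // n IH A l; rewrite ltnS => ln cl hl.
have step A' l' : (size l' <= n)%N -> cells A' l' -> acyclic A' l' ->
    forest (without A' (map hi l')).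
  case/lastP: l' => [|l' d] sl' cl' hl'.
    by apply: sub_forest (acyclic_forest hl') => e /andP[].
  rewrite size_rcons in sl'.
  have hd := acyclic_without_top _ cl' hl'.
  have cd : cells (without A' [:: hi d]) l'.
    case: cl' => cl'; rewrite pairwise_rcons => /andP[/allP std st]; split=> // d' d'l.
    have /and4P[h1 h2 h3 h4] : cellular A' d' by apply: cl'; rewrite mem_rcons inE d'l orbT.
    apply/and4P; split=> //; apply/allP => o od; rewrite /without (allP h2) //= inE.
    by have /andP[+ _] := std _ d'l; apply: contra => /eqP <-; apply: map_f.
  have [|fh _] := IH _ _ sl' cd (hd _).
    by move=> A2 l2 s2 c2 h2; apply: (IH _ _ _ c2 h2).2; apply: leq_ltn_trans s2 sl'.
  apply: sub_forest fh => e; rewrite /without map_rcons mem_rcons !inE negb_or.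
  by rewrite -!andbA.
split; first exact: step.
have := step A (rev (map swap l)); rewrite size_rev size_map => /(_ ln).
move=> /(_ (cells_swap cl) (acyclic_swap hl)); apply: sub_forest => e.
by rewrite /without map_rev mem_rev -map_comp.
Qed.

Definition primitive (T : eqType) (w : seq T) :=
  forall n, (0 < n < size w)%N -> rot n w != w.

(** Once the cells above it are removed, [d] is the top cell, and its boundary meets no bottom edge
    but its own. So apart from [lo d] it runs in a forest; it crosses [lo d] once by primitivity,
    and the rest is a reduced walk of the forest, which repeats no edge. *)
Lemma staggered_uniq A l : cells A l -> acyclic A l ->
  (forall d, d \in l -> primitive (bd d)) ->
  forall d, d \in l -> uniq (unzip1 (bd d)).
Proof.
elim/last_ind: l A => // l d IH A cl hl prim d'.
rewrite mem_rcons inE => /predU1P[->|d'l]; last first.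
  apply: (IH (without A [:: hi d])) => //.
  - case: cl => cl; rewrite pairwise_rcons => /andP[/allP std st]; split=> // d2 d2l.
    have /and4P[h1 h2 h3 h4] : cellular A d2 by apply: cl; rewrite mem_rcons inE d2l orbT.
    apply/and4P; split=> //; apply/allP => o od; rewrite /without (allP h2) //= inE.
    by have /andP[+ _] := std _ d2l; apply: contra => /eqP <-; apply: map_f.
  - apply: acyclic_without_top cl hl => A' l' _ c' h'.
    by have [] := staggered_forest c' h'.
  - by move=> d2 d2l; apply: prim; rewrite mem_rcons inE d2l orbT.
have [_ fA] := staggered_forest cl hl.
case: cl => cl; rewrite pairwise_rcons => /andP[/allP std st].
have dl : d \in rcons l d by rewrite mem_rcons mem_head.
have /and4P[cd dA hd ld] := cl _ dl.
have [|o [p [n [rd oe pp cp [Ap np]]]]] := forest_unique_crossing fA cd _ ld (prim _ dl).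
  move=> o od oe; rewrite /without (allP dA) //= map_rcons mem_rcons inE negb_or oe /=.
  apply/negP=> /mapP[d2 d2l od2]; have /andP[_] := std _ d2l.
  by rewrite -od2 map_f.
rewrite -(rot_uniq n) /unzip1 -map_rot rd /= oe np /=.
case: p pp Ap {rd cp np} => // o' p /= /andP[_ pp] Ap.
exact: forest_uniq fA pp Ap.
Qed.

End StaggeredGraph.

(** * Towers *)

Section Words.
Variable F : groupType.
Local Notation letter := (F * bool)%type.
Local Notation dart := (F * F * bool)%type.
Implicit Types (l : letter) (w : seq letter) (f : F) (c : F * F -> rat).

Definition letter_val l := if l.2 then l.1 else l.1^-1.
Definition letter_inv l : letter := (l.1, ~~ l.2).
Definition word_val w := foldr (fun l f => letter_val l * f) 1 w.
Definition word_inv w := rev (map letter_inv w).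
Definition word_over (B : set F) w := forall l, l \in w -> B l.1.

(* the edge (f, x) of the Cayley graph goes from f to f * x *)
Definition dart_at f l : dart := (if l.2 then f else f * l.1^-1, l.1, l.2).
Fixpoint darts f w : seq dart :=
  if w is l :: w' then dart_at f l :: darts (f * letter_val l) w' else [::].

Lemma word_val_cat w1 w2 : word_val (w1 ++ w2) = word_val w1 * word_val w2.
Proof. by elim: w1 => [|l w IH] /=; rewrite ?mul1g // IH mulgA. Qed.

Lemma letter_val_inv l : letter_val (letter_inv l) = (letter_val l)^-1.
Proof. by case: l => x []; rewrite /letter_val //= invgK. Qed.

Lemma word_inv_cons l w : word_inv (l :: w) = word_inv w ++ [:: letter_inv l].
Proof. by rewrite /word_inv /= rev_cons cats1. Qed.

Lemma word_val_inv w : word_val (word_inv w) = (word_val w)^-1.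
Proof.
elim: w => [|l w IH]; first by rewrite invg1.
by rewrite word_inv_cons word_val_cat IH /= letter_val_inv mulg1 invgM.
Qed.

Lemma word_val_nseq m w : word_val (flatten (nseq m w)) = word_val w ^+ m.
Proof. by elim: m => //= m IH; rewrite word_val_cat IH expgS. Qed.

Lemma darts_cat f w1 w2 :
  darts f (w1 ++ w2) = darts f w1 ++ darts (f * word_val w1) w2.
Proof.
by elim: w1 f => [|l w IH] f /=; rewrite ?mulg1 // IH mulgA.
Qed.

Lemma darts_inv f w :
  darts f (word_inv w) = rev (map (@orev _) (darts (f * (word_val w)^-1) w)).
Proof.
elim: w f => //= l w IH f; rewrite word_inv_cons darts_cat IH word_val_inv rev_cons /=.
rewrite -cats1 invgM !mulgA mulgVK; congr (_ ++ [:: _]).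
rewrite /dart_at /orev /letter_inv /letter_val.
by case: l => x [] /=; rewrite ?invgK ?mulgVK ?mulgK.
Qed.

Lemma darts_shift f w :
  darts f w = [seq (f * o.1.1, o.1.2, o.2) | o <- darts 1 w].
Proof.
have gen g : darts (f * g) w = [seq (f * o.1.1, o.1.2, o.2) | o <- darts g w].
  elim: w g => //= l w IH g; rewrite -mulgA IH; congr cons.
  by rewrite /dart_at; case: l.2; rewrite //= mulgA.
by rewrite -gen mulg1.
Qed.

Lemma darts_letters f w : [seq (o.1.2, o.2) | o <- darts f w] = w.
Proof. by elim: w f => //= l w IH f; rewrite IH; case: l. Qed.

Lemma wsum_rev c (p : seq dart) : wsum c (rev (map (@orev _) p)) = (- wsum c p)%R.
Proof.
rewrite /wsum big_rev /= big_map -sumrN; apply: eq_bigr => o _.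
by case: o => e [] /=; rewrite ?opprK.
Qed.

Lemma wsum_potential (B : set F) c (h : F -> rat) f w :
  (forall f x, B x -> h (f * x) = (h f + c (f, x))%R) -> word_over B w ->
  wsum c (darts f w) = (h (f * word_val w)%g - h f)%R.
Proof.
move=> hc; elim: w f => [|l w IH] f wB; first by rewrite /wsum big_nil mulg1 subrr.
rewrite /= wsum_cons IH; last by move=> l' l'w; apply: wB; rewrite inE l'w orbT.
have Bl : B l.1 by apply: wB; rewrite mem_head.
rewrite mulgA; suff -> : (if (dart_at f l).2 then c (dart_at f l).1
   else - c (dart_at f l).1)%R = (h (f * letter_val l)%g - h f)%R.
  by rewrite addrC addrA subrK.
rewrite /dart_at /letter_val /=; case: l.2; first by rewrite hc // addrAC subrr add0r.
by have := hc (f / l.1) _ Bl; rewrite mulgVK => ->; rewrite opprD addrA subrr add0r.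
Qed.

End Words.

Lemma count_sub_eq (T : eqType) (a b : pred T) (s : seq T) :
  subpred a b -> (count b s <= count a s)%N -> {in s, subpred b a}.
Proof.
move=> ab; elim: s => // x s IH /= le y; have := sub_count ab s => le2.
rewrite inE => /predU1P[-> bx|ys].
  by apply: contraTT le => /negbTE ax; rewrite bx ax /= -ltnNge; lia.
apply: IH => //; move: le; case ax: (a x); first by rewrite (ab _ ax) leq_add2l.
by rewrite add0n; apply: leq_trans; apply: leq_addl.
Qed.

(** * The finest preorder compatible with edges and relators *)

Section FinestPreorder.
Variables (F : groupType) (ET Q : seq (F * F)).
Local Notation T := (map fst ET ++ [seq e.1 * e.2 | e <- ET]).

Definition equivalent (le : rel F) f g := le f g && le g f.

(** The equality in [adapted_edge] both folds edges with the same generator and equivalent sources,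
    and makes passing along such edges preserve strict inequalities. [Q] will hold the start and end
    points of lifted relators. *)
Record adapted (le : rel F) : Prop := Adapted {
  adapted_total : total le;
  adapted_trans : transitive le;
  adapted_edge : forall f g x, (f, x) \in ET -> (g, x) \in ET ->
    le (f * x) (g * x) = le f g;
  adapted_glue : forall q, q \in Q -> equivalent le q.1 q.2 }.

(* h refines a coarser preorder lexicographically, so it is constant on the classes of a
   minimal one. *)
Lemma finest_adapted : exists2 le : rel F, adapted le &
  forall h : F -> rat,
    (forall f g x, (f, x) \in ET -> (g, x) \in ET -> equivalent le f g ->
       h (f * x)%g - h f = h (g * x)%g - h g)%R ->
    (forall q, q \in Q -> h q.1 = h q.2) ->
    forall f g, f \in T -> g \in T -> equivalent le f g -> h f = h g.
Proof.
pose mu (le : rel F) := count (fun p => le p.1 p.2) [seq (f, g) | f <- T, g <- T].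
have [le] : exists2 le, adapted le & forall le', adapted le' -> (mu le <= mu le')%N.
  (* The preorder with a single class is adapted, so a minimum exists. Only pairs in [T] are
     counted, hence the conclusion is restricted to [T]. *)
  have ex0 : exists n, `[< exists2 le, adapted le & mu le = n >].
    by exists (mu (fun _ _ => true)); apply/asboolP; exists (fun _ _ => true).
  case: (ex_minnP ex0) => n /asboolP[le ale <-] min.
  by exists le => // le' ale'; apply: min; apply/asboolP; exists le'.
move=> ale min; exists le => // h hE hQ f g fT gT fg.
pose le' f g := le f g && (le g f ==> (h f <= h g)%R).
have [tot tr edge glue] := ale.
have ale' : adapted le'.
  split.
  - move=> x y; rewrite /le'; case/orP: (tot x y) => xy; rewrite xy /=.
      case: (boolP (le y x)) => yx //=.
      by rewrite le_total.
    by case: (boolP (le x y)) => //= _; rewrite le_total.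
  - move=> y x z /andP[xy hxy] /andP[yz hyz]; rewrite /le' (tr _ _ _ xy yz) /=.
    apply/implyP => zx; move: hxy hyz; rewrite (tr _ _ _ yz zx) (tr _ _ _ zx xy) /=.
    exact: le_trans.
  - move=> x y a xa ya; rewrite /le' !edge //; case: (boolP (le x y)) => //= xy.
    case: (boolP (le y x)) => //= yx.
    have := hE _ _ _ xa ya; rewrite /equivalent xy yx => /(_ isT).
    by move=> e; apply/idP/idP; lra.
  - move=> q qQ; have /andP[h1 h2] := glue _ qQ.
    by rewrite /equivalent /le' h1 h2 (hQ _ qQ) lexx.
have sub p : le' p.1 p.2 -> le p.1 p.2 by case/andP.
have key : {in [seq (f, g) | f <- T, g <- T], forall p, le p.1 p.2 -> le' p.1 p.2}.
  by apply: count_sub_eq => //; apply: (min le' ale').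
have in_pairs x y : x \in T -> y \in T -> (x, y) \in [seq (f, g) | f <- T, g <- T].
  by move=> xT yT; apply/allpairsP; exists (x, y).
have /andP[lfg lgf] := fg.
have /andP[_] := key _ (in_pairs _ _ fT gT) lfg.
have /andP[_] := key _ (in_pairs _ _ gT fT) lgf.
by rewrite /= lfg lgf /=; lra.
Qed.
End FinestPreorder.

Section Extremum.
Variables (T : eqType) (r : rel T).
Hypotheses (rt : total r) (rtr : transitive r).

Definition fold_best x0 (s : seq T) := foldr (fun x y => if r y x then x else y) x0 s.

Lemma fold_best_mem x0 s : fold_best x0 s \in x0 :: s.
Proof.
elim: s => [|x s IH] /=; first by rewrite mem_head.
case: ifP => _; first by rewrite !inE eqxx orbT.
by move: IH; rewrite !inE => /orP[->//|->]; rewrite !orbT.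
Qed.

Lemma fold_best_ge x0 s x : x \in x0 :: s -> r x (fold_best x0 s).
Proof.
elim: s x => [|y s IH] x; first by rewrite inE => /eqP ->; case/orP: (rt x0 x0).
rewrite /= !inE orbCA => /orP[/eqP ->|]; case: ifP => ry.
- by case/orP: (rt y y).
- by case/orP: (rt y (fold_best x0 s)) => //; rewrite ry.
- by rewrite -in_cons => /IH /rtr; apply.
- by rewrite -in_cons => /IH.
Qed.
End Extremum.

(** * The quotient graph of classes of vertices *)

Section QuotientGraph.
Variables (F : groupType) (ET Q : seq (F * F)) (le : rel F).
Hypothesis ale : adapted ET Q le.
Local Notation letter := (F * bool)%type.
Local Notation dart := (F * F * bool)%type.
Local Notation T := (map fst ET ++ [seq e.1 * e.2 | e <- ET]).
Local Notation "f ~ g" := (equivalent le f g) (at level 70).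
Local Notation "f -< g" := (~~ le g f) (at level 70).
Local Notation edges_in f w := (walk_in (fun e => e \in ET) (darts f w)).
Implicit Types (f g : F) (l : letter) (w : seq letter).

Let tot : total le := adapted_total ale.
Let tr : transitive le := adapted_trans ale.

Lemma equivalent_refl f : f ~ f.
Proof. by rewrite /equivalent; case/orP: (tot f f) => ->. Qed.
Lemma equivalent_sym f g : (f ~ g) = (g ~ f).
Proof. exact: andbC. Qed.
Lemma equivalent_trans g f h : f ~ g -> g ~ h -> f ~ h.
Proof.
by move=> /andP[a b] /andP[c d]; rewrite /equivalent (tr a c) (tr d b).
Qed.
Lemma equivalent_left f g h : f ~ g -> (f ~ h) = (g ~ h).
Proof.
move=> fg; apply/idP/idP; apply: equivalent_trans; last by [].
by rewrite equivalent_sym.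
Qed.

Lemma edges_in_cons f l w :
  edges_in f (l :: w) = ((dart_at f l).1 \in ET) && edges_in (f * letter_val l) w.
Proof. by []. Qed.

Lemma edges_in_cat f w1 w2 :
  edges_in f (w1 ++ w2) = edges_in f w1 && edges_in (f * word_val w1) w2.
Proof. by rewrite darts_cat /walk_in all_cat. Qed.

Lemma edges_in_inv f w :
  edges_in f (word_inv w) = edges_in (f * (word_val w)^-1) w.
Proof. by rewrite darts_inv /walk_in all_rev all_map. Qed.

Lemma le_step f g l : (dart_at f l).1 \in ET -> (dart_at g l).1 \in ET ->
  le (f * letter_val l) (g * letter_val l) = le f g.
Proof.
rewrite /dart_at /letter_val; case: l => x [] /= fE gE.
  exact: (adapted_edge ale fE gE).
by rewrite -(adapted_edge ale fE gE) !mulgVK.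
Qed.

Lemma le_base f g l : (dart_at f l).1 \in ET -> (dart_at g l).1 \in ET ->
  le (dart_at f l).1.1 (dart_at g l).1.1 = le f g.
Proof.
move=> fE gE; rewrite -(le_step fE gE); move: fE gE.
rewrite /dart_at /letter_val; case: l => x [] //= fE gE.
by rewrite (adapted_edge ale fE gE).
Qed.

Lemma le_along f g w : edges_in f w -> edges_in g w ->
  le (f * word_val w) (g * word_val w) = le f g.
Proof.
elim: w f g => [|l w IH] f g; first by rewrite !mulg1.
rewrite !edges_in_cons => /andP[fl fw] /andP[gl gw].
by rewrite !mulgA IH // le_step.
Qed.

Lemma equivalent_along f g w : edges_in f w -> edges_in g w ->
  (f * word_val w ~ g * word_val w) = (f ~ g).
Proof. by move=> fw gw; rewrite /equivalent !le_along. Qed.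

(** Walks reading the same word stay parallel, so each edge of the lower one has a strictly higher
    partner with the same generator. This is the source of staggering. *)
Lemma lt_edges f g w e : f -< g -> edges_in f w -> edges_in g w ->
  e \in unzip1 (darts f w) ->
  exists e', [/\ e' \in unzip1 (darts g w), e'.2 = e.2 & e.1 -< e'.1].
Proof.
elim: w f g => //= l w IH f g fg /andP[fl fw] /andP[gl gw].
rewrite inE => /predU1P[->|ew].
  by exists (dart_at g l).1; rewrite mem_head le_base.
have [|e' [h1 h2 h3]] := IH _ _ _ fw gw ew; first by rewrite le_step.
by exists e'; rewrite inE h1 orbT.
Qed.

Lemma gt_edges f g w e : f -< g -> edges_in f w -> edges_in g w ->
  e \in unzip1 (darts g w) ->
  exists e', [/\ e' \in unzip1 (darts f w), e'.2 = e.2 & e'.1 -< e.1].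
Proof.
elim: w f g => //= l w IH f g fg /andP[fl fw] /andP[gl gw].
rewrite inE => /predU1P[->|ew].
  by exists (dart_at f l).1; rewrite mem_head le_base.
have [|e' [h1 h2 h3]] := IH _ _ _ fw gw ew; first by rewrite le_step.
by exists e'; rewrite inE h1 orbT.
Qed.

Lemma edge_src f x : (f, x) \in ET -> f \in T.
Proof. by move=> fx; rewrite mem_cat (map_f fst fx). Qed.

Lemma edge_tgt f x : (f, x) \in ET -> f * x \in T.
Proof.
by move=> fx; rewrite mem_cat orbC (map_f (fun e => e.1 * e.2) fx).
Qed.

Lemma dart_src f l : (dart_at f l).1 \in ET -> f \in T.
Proof.
rewrite /dart_at; case: l => x [] /=; first exact: edge_src.
by move/edge_tgt; rewrite mulgVK.
Qed.

Lemma dart_tgt f l : (dart_at f l).1 \in ET -> f * letter_val l \in T.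
Proof.
rewrite /dart_at /letter_val; case: l => x [] /=; first exact: edge_tgt.
exact: edge_src.
Qed.

(* meaningful only for f in T, where it takes values in T *)
Definition rep f := choose (fun t => (f ~ t) && (t \in T)) f.

Lemma repP f : f \in T -> f ~ rep f /\ rep f \in T.
Proof.
move=> fT; apply/andP; rewrite /rep.
by apply: (@chooseP _ (fun t => (f ~ t) && (t \in T)) f); rewrite equivalent_refl.
Qed.

Lemma rep_eq f g : f \in T -> g \in T -> (rep f == rep g) = (f ~ g).
Proof.
move=> fT gT; have [ff _] := repP fT; have [gg _] := repP gT.
apply/eqP/idP => [e|fg].
  by apply: equivalent_trans ff _; rewrite e equivalent_sym.
rewrite /rep (@eq_choose _ _ (fun t => (g ~ t) && (t \in T))); last first.
  by move=> t; rewrite (equivalent_left _ fg).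
by apply: choose_id; rewrite ?equivalent_refl ?gT // equivalent_sym fg.
Qed.

Definition qedge (e : F * F) := (rep e.1, e.2).
Definition qdart (o : dart) := (qedge o.1, o.2).
Definition qsrc (e : F * F) := e.1.
(* the target of a class of edges is read off an arbitrary representative *)
Definition qtgt (e : F * F) :=
  let e' := nth e ET (find (fun e' => qedge e' == e) ET) in rep (e'.1 * e'.2).
Local Notation qadj := (adj qsrc qtgt).

Lemma qtgtE f x : (f, x) \in ET -> qtgt (qedge (f, x)) = rep (f * x).
Proof.
move=> fx; rewrite /qtgt; set P := fun _ => _; set e := nth _ _ _.
have hP : has P ET by apply/hasP; exists (f, x) => //; apply: eqxx.
have eET : e \in ET by apply: mem_nth; rewrite -has_find.
have /eqP[e1 e2] : P e by apply: nth_find.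
clearbody e; case: e eET e1 e2 => g y /= gy gf yx; subst y.
apply/eqP; rewrite rep_eq ?(edge_tgt fx) ?(edge_tgt gy) //.
rewrite /equivalent !(adapted_edge ale) // -/(g ~ f) -rep_eq ?(edge_src fx) ?(edge_src gy) //.
exact/eqP.
Qed.

Lemma qsrc_dart f l : (dart_at f l).1 \in ET ->
  osrc qsrc qtgt (qdart (dart_at f l)) = rep f.
Proof.
rewrite /dart_at /osrc /qdart; case: l => x [] //= fx.
by rewrite qtgtE // mulgVK.
Qed.

Lemma qtgt_dart f l : (dart_at f l).1 \in ET ->
  otgt qsrc qtgt (qdart (dart_at f l)) = rep (f * letter_val l).
Proof.
rewrite /dart_at /otgt /qdart /letter_val; case: l => x [] //= fx.
by rewrite qtgtE.
Qed.

Definition qwalk f w := map qdart (darts f w).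
Definition reduced_letters l l' := l' != letter_inv l.

Lemma qadj_dart f l l' : edges_in f [:: l; l'] -> reduced_letters l l' ->
  qadj (qdart (dart_at f l)) (qdart (dart_at (f * letter_val l) l')).
Proof.
move=> /and3P[fl fl' _] red; rewrite /adj qtgt_dart // qsrc_dart // eqxx /=.
apply: contra red => /eqP; rewrite /qdart /orev /dart_at /letter_inv /qedge /=.
by case: l' {fl'} => x' b' /= [_ -> ->].
Qed.

Lemma qwalk_path f l w : edges_in f (l :: w) -> path reduced_letters l w ->
  path qadj (qdart (dart_at f l)) (qwalk (f * letter_val l) w).
Proof.
elim: w f l => //= l' w IH f l /and3P[fl fl' fw] /andP[ll' lw].
by rewrite qadj_dart ?IH //= ?fl ?fl'.
Qed.

Lemma qwalk_cycle f w : edges_in f w -> cycle reduced_letters w ->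
  f ~ f * word_val w -> cycle qadj (qwalk f w).
Proof.
case: w => // l w fw; rewrite /cycle rcons_path => /andP[lw wl] ff.
rewrite /qwalk /= rcons_path; apply/andP; split; first exact: qwalk_path.
have fl : (dart_at f l).1 \in ET by case/andP: fw.
case/lastP: w wl fw ff {lw} => [|w l'] wl fw ff.
  rewrite /adj qtgt_dart // qsrc_dart //= eq_sym rep_eq ?(dart_src fl) ?(dart_tgt fl) //.
  rewrite /= mulg1 in ff; rewrite ff; apply: contra wl => /eqP.
  rewrite /qdart /orev /dart_at /letter_inv /qedge /=.
  by case: (l) => x [] /= [].
have fw' : edges_in f (l :: w) && edges_in (f * word_val (l :: w)) [:: l'].
  by rewrite -edges_in_cat cats1.
have /andP[_ /andP[fl' _]] := fw'.
rewrite -cats1 darts_cat map_cat last_cat /= /adj qsrc_dart //.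
rewrite [word_val _]/= !mulgA in fl'.
rewrite qtgt_dart // eq_sym rep_eq ?(dart_src fl) ?(dart_tgt fl') //.
move: ff; rewrite -cats1 /= word_val_cat /= mulg1 !mulgA => ->.
rewrite last_rcons in wl.
apply: contra wl => /eqP; rewrite /qdart /orev /dart_at /letter_inv /qedge /=.
by case: (l) => x b /= [_ -> ->].
Qed.

Lemma qdart_eq f g l : f ~ g -> (dart_at f l).1 \in ET -> (dart_at g l).1 \in ET ->
  qdart (dart_at f l) = qdart (dart_at g l).
Proof.
move=> fg fl gl; rewrite /qdart /qedge; congr (_, _, _).
apply/eqP; rewrite rep_eq; last 2 first.
- by case: (dart_at f l) fl => -[x y] b; apply: edge_src.
- by case: (dart_at g l) gl => -[x y] b; apply: edge_src.
by rewrite /equivalent !le_base.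
Qed.

Lemma qwalk_eq f g w : f ~ g -> edges_in f w -> edges_in g w -> qwalk f w = qwalk g w.
Proof.
elim: w f g => // l w IH f g fg; rewrite !edges_in_cons => /andP[fl fw] /andP[gl gw].
rewrite /qwalk /= (qdart_eq fg) //; congr cons; apply: IH => //.
by rewrite /equivalent !le_step.
Qed.

Lemma qwalk_letters f w : map (fun o => (o.1.2, o.2)) (qwalk f w) = w.
Proof. by rewrite -map_comp -[RHS](darts_letters f). Qed.

Lemma qwalk_primitive f w : primitive w -> primitive (qwalk f w).
Proof.
move=> prim n; rewrite size_map -(size_map (fun o => (o.1.2, o.2))) darts_letters => nw.
apply: contra (prim _ nw) => /eqP e.
by rewrite -(qwalk_letters f w) -map_rot e.
Qed.

Definition quotient_edges e := e \in map qedge ET.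

Lemma qwalk_in f w : edges_in f w -> walk_in quotient_edges (qwalk f w).
Proof.
move=> /allP fw; apply/allP => o /mapP[o' o'w ->].
exact: (map_f qedge (fw _ o'w)).
Qed.

End QuotientGraph.

Lemma uniq_map_inj (T U : eqType) (f : T -> U) (s : seq T) x y :
  uniq (map f s) -> x \in s -> y \in s -> f x = f y -> x = y.
Proof.
elim: s => //= z s IH /andP[zs us]; rewrite !inE => /predU1P[->|xs] /predU1P[->|ys] //.
- by move=> e; case/negP: zs; rewrite e map_f.
- by move=> e; case/negP: zs; rewrite -e map_f.
exact: IH.
Qed.

Lemma strict_transversal (T : eqType) (le : rel T) (s : seq T) :
  total le -> transitive le -> exists l : seq T,
  [/\ {subset l <= s}, pairwise (fun x y => ~~ le y x) l &
      forall x, x \in s -> exists2 y, y \in l & le x y && le y x].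
Proof.
move=> tot tr; elim: s => [|x s [l [ls pl cov]]]; first by exists [::].
have xx : le x x by case/orP: (tot x x).
have [/hasP[y yl xy]|nx] := boolP (has (fun y => le x y && le y x) l).
  exists l; split=> // [z zl|z]; first by rewrite inE ls ?orbT.
  by rewrite inE => /predU1P[->|/cov//]; exists y.
exists ([seq y <- l | ~~ le x y] ++ x :: [seq y <- l | ~~ le y x]).
have cover y : y \in l -> (~~ le x y) || (~~ le y x).
  by move=> yl; rewrite -negb_and; apply: contra nx => h; apply/hasP; exists y.
split.
- move=> z; rewrite mem_cat inE !mem_filter inE => /or3P[/andP[_ /ls ->]|->|/andP[_ /ls ->]];
  by rewrite ?orbT.
- rewrite pairwise_cat /= !(subseq_pairwise (filter_subseq _ _) pl) /= andbT.
  apply/andP; split; last by apply/allP => y; rewrite mem_filter => /andP[].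
  apply/allrelP => y z; rewrite mem_filter inE => /andP[xy _].
  rewrite mem_filter => /predU1P[->//|/andP[zx _]].
  by apply: contra xy => zy; case/orP: (tot x z) => [xz|]; [apply: tr xz zy|move=> h; rewrite h in zx].
move=> z; rewrite inE => /predU1P[->|/cov[y yl zy]].
  by exists x; rewrite ?xx // mem_cat inE eqxx orbT.
exists y => //; rewrite mem_cat inE !mem_filter yl !andbT.
by case/orP: (cover _ yl) => ->; rewrite ?orbT.
Qed.

(** * The 2-cells of the quotient and their top edges *)

Section Tower.
Variables (F : groupType) (B : set F).
Hypothesis hB : free_basis B.
Local Notation letter := (F * bool)%type.
Variables (a : letter) (s' : seq letter) (m : nat) (ET : seq (F * F)) (qs : seq F).
Local Notation s := (a :: s').
Local Notation sigma := (word_val s).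
Local Notation rho := (flatten (nseq m s)).
Local Notation edges_in f w := (walk_in (fun e => e \in ET) (darts f w)).
Hypotheses (m_gt0 : (0 < m)%N) (sB : word_over B s).
Hypotheses (s_red : cycle (@reduced_letters F) s) (s_prim : primitive s).
Hypotheses (ET_B : forall e, e \in ET -> B e.2).
Hypothesis qs_in : forall q, q \in qs -> edges_in q rho.

Lemma edges_in_nseq f j : edges_in f rho -> (j < m)%N -> edges_in (f * sigma ^+ j) s.
Proof.
move=> fr jm; move: fr.
rewrite (_ : m = (j + (m - j.+1).+1)%N); last by clear -jm; lia.
rewrite nseqD flatten_cat edges_in_cat word_val_nseq => /andP[_].
by rewrite [flatten _]/= -/(s ++ _) edges_in_cat => /andP[].
Qed.

Local Notation Q := [seq (q, q * sigma ^+ m) | q <- qs].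

Section Adapted.
Variable le : rel F.
Hypothesis ale : adapted ET Q le.
Local Notation "f ~ g" := (equivalent le f g) (at level 70).

(* a total preorder compatible with right multiplication by sigma has no strict
   sigma-cycle *)
Lemma root_loop q j : q \in qs -> (j <= m)%N -> q ~ q * sigma ^+ j.
Proof.
move=> qqs jm; have qr := qs_in qqs.
have step i : (i < m)%N -> le (q * sigma ^+ i) (q * sigma ^+ i.+1) = le q (q * sigma)
    /\ le (q * sigma ^+ i.+1) (q * sigma ^+ i) = le (q * sigma) q.
  elim: i => [|i IH] im; first by rewrite expg0 expg1 mulg1.
  have eS k : q * sigma ^+ k * sigma = q * sigma ^+ k.+1 by rewrite -mulgA -expgSr.
  have e1 := edges_in_nseq qr (ltnW im); have e2 := edges_in_nseq qr im.
  have := le_along ale e1 e2; have := le_along ale e2 e1; rewrite !eS => -> ->.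
  exact: IH (ltnW im).
have glue : q ~ q * sigma ^+ m by apply: (adapted_glue ale (q := (q, _))); apply: map_f.
have chain (r : rel F) : reflexive r -> transitive r ->
    (forall i, (i < m)%N -> r (q * sigma ^+ i) (q * sigma ^+ i.+1)) ->
    r q (q * sigma ^+ j) && r (q * sigma ^+ j) (q * sigma ^+ m).
  move=> rr rt rs.
  have up i k : (i + k <= m)%N -> r (q * sigma ^+ i) (q * sigma ^+ (i + k)).
    elim: k => [|k IH] ik; first by rewrite addn0.
    by apply: rt (IH _) _; rewrite ?addnS ?rs //; clear -ik; lia.
  have := up 0%N j jm; rewrite expg0 mulg1 add0n => -> /=.
  by rewrite -(subnKC jm) up // subnKC.
have rfl : reflexive le by move=> x; case/orP: (adapted_total ale x x).
have /andP[g1 g2] := glue; have trl := adapted_trans ale.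
case/orP: (adapted_total ale q (q * sigma)) => h.
  have /andP[h1 h2] := chain le rfl trl (fun i im => etrans (step i im).1 h).
  by rewrite /equivalent h1 (trl _ _ _ h2 g2).
have trl' : transitive (fun x y => le y x) by move=> y x z xy yz; apply: trl yz xy.
have /andP[h1 h2] := chain (fun x y => le y x) rfl trl' (fun i im => etrans (step i im).2 h).
by rewrite /equivalent h1 (trl _ _ _ g1 h2).
Qed.

Definition base_edges d := [seq e <- unzip1 (darts d s) | e.2 == a.1].
Definition top_edge d :=
  fold_best (fun e e' => le e.1 e'.1) (dart_at d a).1 (base_edges d).
Definition bottom_edge d :=
  fold_best (fun e e' => le e'.1 e.1) (dart_at d a).1 (base_edges d).
(** The boundary is the root [s] and not [rho]: by [root_loop] the root already closes up in the
    quotient, and [staggered_uniq] needs a primitive boundary. Top and bottom are taken among the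
    edges with the generator of [a], the first edge of the walk being one of them. *)
Definition quotient_cell d :=
  (qwalk ET le d s, qedge ET le (top_edge d), qedge ET le (bottom_edge d)).

Lemma base_edgesP d e : e \in (dart_at d a).1 :: base_edges d ->
  e \in unzip1 (darts d s) /\ e.2 = a.1.
Proof.
rewrite inE mem_filter => /orP[/eqP ->|/andP[/eqP -> ->]] //.
by rewrite mem_head.
Qed.

Lemma top_edge_mem d : top_edge d \in unzip1 (darts d s) /\ (top_edge d).2 = a.1.
Proof. exact: base_edgesP (fold_best_mem _ _ _). Qed.

Lemma bottom_edge_mem d : bottom_edge d \in unzip1 (darts d s) /\ (bottom_edge d).2 = a.1.
Proof. exact: base_edgesP (fold_best_mem _ _ _). Qed.

Lemma top_edge_ge d e : e \in unzip1 (darts d s) -> e.2 = a.1 -> le e.1 (top_edge d).1.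
Proof.
move=> ed ea; apply: (@fold_best_ge _ (fun e e' => le e.1 e'.1)).
- by move=> x y; apply: adapted_total ale _ _.
- by move=> y x z; apply: adapted_trans ale _ _ _.
by rewrite inE mem_filter ea eqxx ed orbT.
Qed.

Lemma bottom_edge_le d e : e \in unzip1 (darts d s) -> e.2 = a.1 -> le (bottom_edge d).1 e.1.
Proof.
move=> ed ea; apply: (@fold_best_ge _ (fun e e' => le e'.1 e.1)).
- by move=> x y; apply: adapted_total ale _ _.
- by move=> y x z h1 h2; apply: (adapted_trans ale) h2 h1.
by rewrite inE mem_filter ea eqxx ed orbT.
Qed.

Lemma qs_edges q : q \in qs -> edges_in q s.
Proof. by move=> /qs_in/edges_in_nseq/(_ m_gt0); rewrite expg0 mulg1. Qed.

Lemma edge_in_src q e : q \in qs -> e \in unzip1 (darts q s) ->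
  e.1 \in map fst ET ++ [seq e.1 * e.2 | e <- ET].
Proof.
move=> /qs_edges/allP qe /mapP[o oq ->]; have := qe _ oq.
by case: (o.1) => f x; apply: edge_src.
Qed.

Lemma qedge_inj q q' e e' : q \in qs -> q' \in qs ->
  e \in unzip1 (darts q s) -> e' \in unzip1 (darts q' s) ->
  qedge ET le e = qedge ET le e' -> e.1 ~ e'.1.
Proof.
move=> qq qq' eq eq' [/eqP + _].
by rewrite (rep_eq ale) ?(edge_in_src qq eq) ?(edge_in_src qq' eq').
Qed.

Lemma quotient_cellular q : q \in qs ->
  cellular (@qsrc F) (qtgt ET le) (quotient_edges ET le) (quotient_cell q).
Proof.
move=> qq; have qe := qs_edges qq; apply/and4P; split.
- apply: (qwalk_cycle ale) => //.
  by have := root_loop qq m_gt0; rewrite expg1.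
- exact: qwalk_in.
- rewrite /hi /bd /= /unzip1 /qwalk -map_comp (map_comp (qedge ET le) fst).
  exact: map_f (top_edge_mem q).1.
- rewrite /lo /bd /= /unzip1 /qwalk -map_comp (map_comp (qedge ET le) fst).
  exact: map_f (bottom_edge_mem q).1.
Qed.

(** If the walk from the lower [q] met the top edge of [q'], its parallel partner on the walk from
    [q'] would be higher still; dually for the bottom edge. *)
Lemma quotient_staggered q q' : q \in qs -> q' \in qs -> ~~ le q' q ->
  staggered (quotient_cell q) (quotient_cell q').
Proof.
move=> qq qq' lt; have qe := qs_edges qq; have qe' := qs_edges qq'.
have unz d : unzip1 (qwalk ET le d s) = map (qedge ET le) (unzip1 (darts d s)).
  by rewrite /unzip1 /qwalk -map_comp -map_comp.
change ((qedge ET le (top_edge q') \notin unzip1 (qwalk ET le q s)) &&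
  (qedge ET le (bottom_edge q) \notin unzip1 (qwalk ET le q' s))).
rewrite !unz; apply/andP; split; apply/negP.
  move=> /mapP[e eq h]; have [tm ta] := top_edge_mem q'.
  have /andP[le1 _] := qedge_inj qq' qq tm eq h.
  have [e' [e'q e'a]] := lt_edges ale lt qe qe' eq.
  case/negP; apply: (adapted_trans ale) le1; apply: top_edge_ge => //.
  by rewrite e'a -ta; case: h.
move=> /mapP[e eq h]; have [tm ta] := bottom_edge_mem q.
have /andP[_ le1] := qedge_inj qq qq' tm eq h.
have [e' [e'q e'a]] := gt_edges ale lt qe qe' eq.
case/negP; apply: (adapted_trans ale le1); apply: bottom_edge_le => //.
by rewrite e'a -ta; case: h.
Qed.

(** The first hypothesis is what [finest_adapted] provides. A cocycle is lifted to the Cayley graph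
    (by 0 outside [ET]) and integrated to [h]. Along a relator [h] changes by [m] sums around one
    cell, all zero, so [h] respects the gluing; being constant on classes it descends to a
    potential. *)
Lemma quotient_acyclic l :
  (forall h : F -> rat,
    (forall f g x, (f, x) \in ET -> (g, x) \in ET -> f ~ g ->
       h (f * x)%g - h f = h (g * x)%g - h g)%R ->
    (forall q, q \in Q -> h q.1 = h q.2) ->
    forall f g, f \in map fst ET ++ [seq e.1 * e.2 | e <- ET] ->
      g \in map fst ET ++ [seq e.1 * e.2 | e <- ET] -> f ~ g -> h f = h g) ->
  {subset l <= qs} -> (forall q, q \in qs -> exists2 d, d \in l & q ~ d) ->
  acyclic (@qsrc F) (qtgt ET le) (quotient_edges ET le) (map quotient_cell l).
Proof.
move=> fin lqs cov c c0.
pose c' e := if e \in ET then c (qedge ET le e) else 0%R.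
have [h _ hc] := @free_recursion _ _ hB rat 0%R (fun f x r => r + c' (f, x))%R
  (fun f x r => r - c' (f, x))%R (fun f x r => addrK _ _) (fun f x r => subrK _ _).
have diff f x : (f, x) \in ET -> (h (f * x)%g - h f)%R = c (rep ET le f, x).
  by move=> fx; rewrite hc; [rewrite /= addrC addKr /c' fx|exact: (ET_B fx)].
have eqrep f g : f \in map fst ET ++ [seq e.1 * e.2 | e <- ET] ->
    g \in map fst ET ++ [seq e.1 * e.2 | e <- ET] -> f ~ g -> rep ET le f = rep ET le g.
  by move=> fT gT fg; apply/eqP; rewrite (rep_eq ale).
have hinv : forall f g, f \in map fst ET ++ [seq e.1 * e.2 | e <- ET] ->
    g \in map fst ET ++ [seq e.1 * e.2 | e <- ET] -> f ~ g -> h f = h g.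
  apply: fin => [f g x fx gx fg|_ /mapP[q qq ->] /=].
    by rewrite !diff // (eqrep f g) // ?(edge_src fx) ?(edge_src gx).
  have step j : (j < m)%N -> h (q * sigma ^+ j.+1) = h (q * sigma ^+ j).
    move=> jm; have ej := edges_in_nseq (qs_in qq) jm.
    apply/eqP; rewrite -subr_eq0 expgSr mulgA.
    rewrite -(wsum_potential (c := c') _ hc sB).
    have [d dl qd] := cov _ qq.
    rewrite -(c0 (quotient_cell d)) ?map_f //.
    change (bd (quotient_cell d)) with (qwalk ET le d s).
    have jd : q * sigma ^+ j ~ d.
      by apply: (equivalent_trans ale) qd; rewrite equivalent_sym root_loop // ltnW.
    rewrite -(qwalk_eq ale jd ej (qs_edges (lqs _ dl))) /qwalk /wsum big_map.
    apply/eqP/eq_big_seq => o /(allP ej) oE.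
    by rewrite /c' oE.
  have : forall j, (j <= m)%N -> h (q * sigma ^+ j) = h q.
    elim=> [|j IH] jm; first by rewrite expg0 mulg1.
    by rewrite step // IH // ltnW.
  by move=> ->.
exists h => e /mapP[[f x] fx ->].
rewrite (qtgtE ale fx) /qsrc /= -diff //.
have [ft ftT] := repP ale (edge_tgt fx); have [fs fsT] := repP ale (edge_src fx).
by rewrite -(hinv _ _ (edge_tgt fx) ftT ft) -(hinv _ _ (edge_src fx) fsT fs).
Qed.

End Adapted.

(** All that the identity theorem needs from the complex, restated upstairs: [o0] is the lift of the
    top edge of [d], crossed once by [staggered_uniq] and out of reach of lower cells by
    [lt_edges]. *)
Lemma tower : exists (le : rel F) (l : seq F),
  [/\ adapted ET Q le, {subset l <= qs}, pairwise (fun x y => ~~ le y x) l,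
      forall q, q \in qs -> exists2 d, d \in l & equivalent le q d &
      forall d, d \in l -> exists o0, [/\ o0 \in darts d s, uniq (darts d s),
        forall o, o \in darts d s -> o.1.2 = o0.1.2 ->
          equivalent le o.1.1 o0.1.1 -> o = o0 &
        forall q o, q \in l -> ~~ le d q -> o \in darts q s -> o.1.2 = o0.1.2 ->
          ~~ le o0.1.1 o.1.1]].
Proof.
have [le ale fin] := finest_adapted ET Q.
have [l [lqs pl cov]] := strict_transversal qs (adapted_total ale) (adapted_trans ale).
exists le, l; split=> // d dl.
have ac := quotient_acyclic ale fin lqs cov.
have ce : cells (@qsrc F) (qtgt ET le) (quotient_edges ET le) (map (quotient_cell le) l).
  split=> [_ /mapP[q ql ->]|]; first by apply: quotient_cellular => //; apply: lqs.
  rewrite pairwise_map; apply: sub_in_pairwise pl; last by apply/allP => x; apply: id.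
  by move=> x y xl yl; apply: quotient_staggered => //; apply: lqs.
have prim c : c \in map (quotient_cell le) l -> primitive (bd c).
  by move=> /mapP[q ql ->]; apply: qwalk_primitive.
have ud := staggered_uniq ce ac prim (map_f _ dl).
have [td ta] := top_edge_mem le d.
have dq := lqs _ dl; have de := qs_edges dq.
have /mapP[o0 o0d eo0] := td.
have ud' : uniq (map (fun o => qedge ET le o.1) (darts d s)).
  by move: ud; rewrite /bd /= /unzip1 -map_comp.
exists o0; split=> //.
- exact: map_uniq ud'.
- move=> o od oa oe; apply: (uniq_map_inj ud' od o0d); rewrite /qedge oa.
  congr (_, _); apply/eqP; rewrite (rep_eq ale) //; apply: (edge_in_src dq).
    exact: map_f od.
  exact: map_f o0d.
- move=> q o ql qd oq oa.
  have [e' [e'd e'a lt]] := lt_edges ale qd (qs_edges (lqs _ ql)) de (map_f fst oq).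
  apply: contra lt => lt; apply: (adapted_trans ale) lt; rewrite -eo0.
  by apply: top_edge_ge => //; rewrite e'a /= oa -eo0.
Qed.

End Tower.

(** * Identities among relators *)

Lemma word_exists (F : groupType) (B : set F) (hB : free_basis B) (f : F) :
  exists w, word_over B w /\ word_val w = f.
Proof.
elim/(basis_ind hB): f => [|f x Bx [w [wB <-]]|f x Bx [w [wB <-]]]; first by exists [::].
  exists (w ++ [:: (x, true)]); split; last by rewrite word_val_cat /= mulg1.
  by move=> l; rewrite mem_cat inE => /orP[/wB//|/eqP ->].
exists (w ++ [:: (x, false)]); split; last by rewrite word_val_cat /= mulg1.
by move=> l; rewrite mem_cat inE => /orP[/wB//|/eqP ->].
Qed.

Lemma le_along_dart (F : groupType) ET Q (le : rel F) (ale : adapted ET Q le) f g w o :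
  walk_in (fun e => e \in ET) (darts f w) -> walk_in (fun e => e \in ET) (darts g w) ->
  o \in darts 1 w -> le (f * o.1.1) (g * o.1.1) = le f g.
Proof.
suff gen h : walk_in (fun e => e \in ET) (darts (f * h) w) ->
    walk_in (fun e => e \in ET) (darts (g * h) w) -> o \in darts h w ->
    le (f * o.1.1) (g * o.1.1) = le (f * h) (g * h).
  by move=> fw gw ow; have := gen 1; rewrite !mulg1; apply.
elim: w h => //= l w IH h /andP[fl fw] /andP[gl gw]; rewrite inE => /predU1P[->|ow].
  rewrite -(le_base ale fl gl) /dart_at /=; case: ifP => //= _; by rewrite !mulgA.
by rewrite (IH (h * letter_val l)) // !mulgA // (le_step ale fl gl).
Qed.

Section Identities.
Variables (F : groupType) (B : set F).
Hypothesis hB : free_basis B.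
Local Notation letter := (F * bool)%type.
Variables (a : letter) (s' : seq letter) (m : nat) (S : set F).
Local Notation s := (a :: s').
Local Notation sigma := (word_val s).
Local Notation rho := (flatten (nseq m s)).
Hypotheses (m_gt0 : (0 < m)%N) (sB : word_over B s).
Hypotheses (s_red : cycle (@reduced_letters F) s) (s_prim : primitive s).
Hypotheses (nS : normal_subgroup S) (Ssigma : S (sigma ^+ m)).

Definition conj_term (r : F) (p : bool * F) :=
  p.2 * (if p.1 then r else r^-1) * p.2^-1.
Definition conj_prod r (L : seq (bool * F)) := foldr (fun p g => conj_term r p * g) 1 L.
Definition bsign (b : bool) : rat := if b then 1%R else (-1)%R.

Variable wd : F -> seq letter.
Hypothesis wdB : forall u, word_over B (wd u).
Hypothesis wdE : forall u, word_val (wd u) = u.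

Local Notation term := (conj_term (sigma ^+ m)).

Definition identity_block (p : bool * F) :=
  wd p.2 ++ (if p.1 then rho else word_inv rho) ++ word_inv (wd p.2).
Definition identity_word L := flatten (map identity_block L).

(** The signed cells met by the lifted identity word, with base points; [P] is the vertex reached so
    far. A negative block runs backwards around its cell, which is thus based at the far end of the
    loop, whence the factor [(sigma ^+ m)^-1]. *)
Fixpoint identity_cells P (L : seq (bool * F)) : seq (rat * F) :=
  if L is p :: L' then
    (bsign p.1, P * p.2 * (if p.1 then 1 else (sigma ^+ m)^-1))
      :: identity_cells (P * term p) L'
  else [::].

Lemma identity_block_val p : word_val (identity_block p) = term p.
Proof.
rewrite /identity_block !word_val_cat word_val_inv wdE /conj_term mulgA.
by case: p.1; rewrite ?word_val_inv word_val_nseq.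
Qed.

Lemma identity_word_val L : word_val (identity_word L) = conj_prod (sigma ^+ m) L.
Proof.
elim: L => //= p L IH; rewrite -IH -identity_block_val /identity_word /=.
by rewrite word_val_cat.
Qed.

Lemma word_over_inv w : word_over B w -> word_over B (word_inv w).
Proof.
by move=> wB l; rewrite mem_rev => /mapP[l' l'w ->]; apply: (wB l').
Qed.

Lemma word_over_cat w w' : word_over B w -> word_over B w' -> word_over B (w ++ w').
Proof. by move=> wB wB' l; rewrite mem_cat => /orP[/wB|/wB']. Qed.

Lemma word_over_rho : word_over B rho.
Proof. by elim: (m) => // k IH; apply: word_over_cat. Qed.

Lemma identity_word_over L : word_over B (identity_word L).
Proof.
elim: L => // p L IH; apply: word_over_cat => //; apply: word_over_cat => //.
apply: word_over_cat; last exact: word_over_inv.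
by case: p.1; [|apply: word_over_inv]; apply: word_over_rho.
Qed.

Lemma darts_over f w e : word_over B w -> e \in unzip1 (darts f w) -> B e.2.
Proof.
move=> wB /mapP[o]; move: wB; elim: w f => //= l w IH f wB.
rewrite inE => /predU1P[-> ->|]; first by apply: wB; rewrite mem_head.
by apply: IH => l' l'w; apply: wB; rewrite inE l'w orbT.
Qed.

Section Edges.
Variable ET : seq (F * F).
Local Notation edges_in f w := (walk_in (fun e => e \in ET) (darts f w)).

Lemma identity_block_edges P p w : edges_in P (identity_block p ++ w) ->
  [/\ edges_in P (wd p.2),
      edges_in (P * p.2 * (if p.1 then 1 else (sigma ^+ m)^-1)) rho,
      edges_in (P * term p) (wd p.2) & edges_in (P * term p) w].
Proof.
rewrite edges_in_cat identity_block_val /identity_block !edges_in_cat wdE.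
move=> /andP[/and3P[h1 h2 h3] h4]; split=> //.
  move: h2; case: p.1; first by rewrite mulg1.
  by rewrite edges_in_inv word_val_nseq.
move: h3; rewrite edges_in_inv wdE /conj_term !mulgA.
by case: p.1; rewrite ?word_val_inv word_val_nseq.
Qed.

Lemma identity_cells_edges P L q : edges_in P (identity_word L) ->
  q \in map snd (identity_cells P L) -> edges_in q rho.
Proof.
elim: L P => //= p L IH P /identity_block_edges[_ h _ hL].
by rewrite inE => /predU1P[->//|]; apply: IH.
Qed.

Variables (Q : seq (F * F)) (le : rel F).
Hypothesis ale : adapted ET Q le.
Local Notation "f ~ g" := (equivalent le f g) (at level 70).

(** Invariance is asked only where equivalence and congruence modulo [S] hold together, so that the
    indicator of a class may be multiplied by a function on the cosets of [S]. *)
Definition invariant_cochain (c : F * F -> rat) := forall f g x,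
  (f, x) \in ET -> (g, x) \in ET -> f ~ g -> S (f^-1 * g) -> c (f, x) = c (g, x).

Lemma wsum_invariant c f g w : invariant_cochain c -> f ~ g -> S (f^-1 * g) ->
  edges_in f w -> edges_in g w -> wsum c (darts f w) = wsum c (darts g w).
Proof.
move=> ci; elim: w f g => // l w IH f g fg Sfg /andP[fl fw] /andP[gl gw].
rewrite /= !wsum_cons (IH _ (g * letter_val l)) //; first last.
- rewrite invgM -mulgA [f^-1 * _]mulgA mulgA.
  by have := nS.2 _ (letter_val l) Sfg; rewrite conjgE !mulgA.
- by rewrite /equivalent !(le_step ale).
congr (_ + _)%R; rewrite /dart_at /= in fl gl *; suff -> : c (if l.2 then f else f / l.1, l.1) =
  c (if l.2 then g else g / l.1, l.1) by [].
apply: ci => //.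
  have := le_base ale fl gl; have := le_base ale gl fl.
  by rewrite /= /equivalent => -> ->.
case: ifP => // _; rewrite invgM invgK.
by have := nS.2 _ (l.1^-1) Sfg; rewrite conjgE invgK !mulgA.
Qed.

(** The path [wd p.2] is followed from [P] and later traced back to [P * term p]. These two vertices
    are equivalent and congruent modulo [S], so both contributions cancel and only the relator loops
    remain. *)
Lemma wsum_identity c P L : invariant_cochain c ->
  (forall q, q \in map snd (identity_cells P L) -> q ~ q * sigma ^+ m) ->
  edges_in P (identity_word L) ->
  wsum c (darts P (identity_word L)) =
    (\sum_(e <- identity_cells P L) e.1 * wsum c (darts e.2 rho))%R.
Proof.
move=> ci; elim: L P => [|p L IH] P glue.
  by rewrite /wsum !big_nil.
rewrite /= => eP; have [e1 e2 e3 e4] := identity_block_edges eP.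
rewrite big_cons -(IH (P * term p)) //; last first.
  by move=> q qL; apply: glue; rewrite inE qL orbT.
rewrite darts_cat wsum_cat identity_block_val; congr (_ + _)%R.
rewrite /identity_block !darts_cat !wsum_cat wdE.
set t := P * p.2 * (if p.1 then 1 else _).
have -> : wsum c (darts P (wd p.2)) = wsum c (darts (P * term p) (wd p.2)).
  apply: wsum_invariant => //.
    rewrite -(equivalent_along ale e1 e3) wdE.
    have /= := glue t (mem_head _ _); rewrite /t /conj_term.
    by case: p.1; rewrite ?mulg1 !mulgA !mulgVK // equivalent_sym.
  rewrite mulKg /conj_term -[p.2 in X in S X]invgK.
  have St : S (if p.1 then sigma ^+ m else (sigma ^+ m)^-1).
    by case: p.1 => //; apply: subgroupV nS.1 _.
  by have := nS.2 _ (p.2^-1) St; rewrite conjgE !invgK mulgA.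
rewrite darts_inv wsum_rev wdE.
have -> : P * p.2 * word_val (if p.1 then rho else word_inv rho) / p.2 = P * term p.
  rewrite /conj_term !mulgA; case: p.1; by rewrite ?word_val_inv word_val_nseq.
rewrite addrCA subrr addr0 /t /bsign; case: p.1; first by rewrite mulg1 mul1r.
by rewrite darts_inv wsum_rev word_val_nseq mulN1r.
Qed.

End Edges.

Lemma wsum_power c q k : wsum c (darts q (flatten (nseq k s))) =
  (\sum_(j < k) wsum c (darts (q * sigma ^+ j) s))%R.
Proof.
elim: k => [|k IH]; first by rewrite big_ord0 /wsum big_nil.
rewrite big_ord_recr -IH -[in LHS]addn1 nseqD flatten_cat darts_cat wsum_cat word_val_nseq.
by rewrite (_ : flatten (nseq 1 s) = s) //= cats0.
Qed.

(** The prefixes and the powers of the relator lie in [S], which is normal: they can be moved to the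
    right of [p.2], where [chi] does not see them. *)
Lemma identity_cells_sum P L (chi : F -> rat) : S P ->
  (forall f z, S z -> chi (f * z) = chi f) ->
  (\sum_(e <- identity_cells P L) e.1 * chi e.2 = \sum_(p <- L) bsign p.1 * chi p.2)%R.
Proof.
move=> SP ci; elim: L P SP => [|p L IH] P SP; first by rewrite !big_nil.
have St : S (term p).
  have : S (if p.1 then sigma ^+ m else (sigma ^+ m)^-1).
    by case: p.1 => //; apply: subgroupV nS.1 _.
  by move=> /(nS.2 _ (p.2^-1)); rewrite conjgE !invgK /conj_term mulgA.
rewrite /= !big_cons IH /=; last exact: subgroupM nS.1 SP St.
congr (_ * _ + _)%R; rewrite ci; last first.
  by case: p.1; [case/subgroupP: nS.1|apply: subgroupV nS.1 _].
by rewrite conjgC ci //; apply: nS.2.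
Qed.

(* Lyndon's identity theorem: chi ranges over the functions on the left cosets of the
   subgroup generated by S and sigma. Phi sums over the m lifts of each cell; the
   coefficients of the classes d of cells vanish from the top one downwards, by evaluating
   cochains supported on the top edge of d. *)
Lemma identity_theorem_word L (chi : F -> rat) :
  conj_prod (sigma ^+ m) L = 1 ->
  (forall f z, S z -> chi (f * z) = chi f) -> (forall f, chi (f * sigma) = chi f) ->
  (\sum_(p <- L) bsign p.1 * chi p.2 = 0)%R.
Proof.
move=> L1 chiS chis.
pose cp := identity_cells 1 L; pose ET := unzip1 (darts 1 (identity_word L)).
have ET_B e : e \in ET -> B e.2 by apply: darts_over; apply: identity_word_over.
have W_in : walk_in (fun e => e \in ET) (darts 1 (identity_word L)).
  by apply/allP => o; apply: map_f.
have qs_in q : q \in map snd cp -> walk_in (fun e => e \in ET) (darts q rho).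
  exact: identity_cells_edges.
have [le [l [ale lqs pl cov top]]] := tower hB m_gt0 sB s_red s_prim ET_B qs_in.
pose Phi (f : F -> rat) := (\sum_(e <- cp) e.1 * \sum_(j < m) f (e.2 * sigma ^+ j)%g)%R.
have inX e j : e \in cp -> (j < m)%N -> let q := e.2 * sigma ^+ j in
    walk_in (fun e => e \in ET) (darts q s) /\ exists2 d, d \in l & equivalent le q d.
  move=> ecp jm q; have qcp := map_f snd ecp.
  split; first exact: edges_in_nseq (qs_in _ qcp) jm.
  have [d dl qd] := cov _ qcp; exists d => //.
  apply: (equivalent_trans ale) qd; rewrite equivalent_sym.
  exact: (root_loop qs_in ale qcp (ltnW jm)).
have eq_Phi f g : (forall q, walk_in (fun e => e \in ET) (darts q s) ->
    forall d, d \in l -> equivalent le q d -> f q = g q) -> Phi f = Phi g.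
  move=> fg; apply: eq_big_seq => e ecp; congr (_ * _)%R; apply: eq_bigr => j _.
  by have [qs [d dl qd]] := inX _ _ ecp (ltn_ord j); apply: fg qd.
have PhiD f g : Phi (fun q => f q + g q)%R = (Phi f + Phi g)%R.
  by rewrite /Phi -big_split; apply: eq_bigr => e _; rewrite big_split mulrDr.
have PhiZ x f : Phi (fun q => x * f q)%R = (x * Phi f)%R.
  rewrite /Phi mulr_sumr; apply: eq_bigr => e _.
  by rewrite -mulr_sumr mulrCA.
have Phi_sum (I : eqType) (r : seq I) f : (forall i, i \in r -> Phi (f i) = 0%R) ->
    Phi (fun q => \sum_(i <- r) f i q)%R = 0%R.
  elim: r => [|i r IH] f0.
    rewrite /Phi big1 // => e _; rewrite big1 ?mulr0 // => j _.
    by rewrite big_nil.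
  rewrite (eq_Phi _ (fun q => f i q + \sum_(i <- r) f i q)%R).
    rewrite PhiD f0 ?mem_head // IH ?addr0 // => i' i'r.
    by apply: f0; rewrite inE i'r orbT.
  by move=> q *; rewrite big_cons.
have Phi_walk c : invariant_cochain ET le c -> Phi (fun q => wsum c (darts q s)) = 0%R.
  move=> ci; have [h h1 hc] := @free_recursion _ _ hB rat 0%R (fun f x r => r + c (f, x))%R
    (fun f x r => r - c (f, x))%R (fun f x r => addrK _ _) (fun f x r => subrK _ _).
  have eW : wsum c (darts 1 (identity_word L)) = 0%R.
    rewrite (wsum_potential 1 hc (@identity_word_over L)).
    by rewrite mul1g identity_word_val L1 subrr.
  rewrite -eW (wsum_identity ale ci _ W_in) => [|q qcp].
    by apply: eq_bigr => e _; rewrite wsum_power.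
  exact: (root_loop qs_in ale qcp (leqnn m)).
have walk_shift c q : wsum c (darts q s) =
    (\sum_(o <- darts 1 s) bsign o.2 * c (q * o.1.1, o.1.2)%g)%R.
  rewrite darts_shift /wsum big_map; apply: eq_bigr => o _ /=.
  by rewrite /bsign; case: o.2; rewrite ?mul1r ?mulN1r.
have ltl x : ~~ (~~ le x x) by rewrite negbK; case/orP: (adapted_total ale x x).
have eq1 d d' q : equivalent le q d -> (equivalent le q d') = (equivalent le d d').
  by move=> qd; apply: (equivalent_left ale).
have eqd x : equivalent le x x by apply: (equivalent_refl ale).
(* Since [l] increases, [l2] holds the highest classes. All [chi'] are treated at once because the
   correction terms involve right translates of [chi']. *)
have claim l2 : forall l1, l = l1 ++ l2 -> forall d, d \in l2 -> forall chi',
    (forall f z, S z -> chi' (f * z) = chi' f) ->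
    Phi (fun q => (equivalent le q d)%:R * chi' q)%R = 0%R.
  elim: l2 => // d l2 IH l1 def_l; have {}IH := IH (rcons l1 d).
  rewrite cat_rcons in IH; have {}IH := IH def_l.
  move=> d'; rewrite inE => /predU1P[->|]; last exact: IH.
  move=> {d'} chi' chi'S.
  have dl : d \in l by rewrite def_l mem_cat mem_head orbT.
  have de : walk_in (fun e => e \in ET) (darts d s) by apply: (qs_edges m_gt0 qs_in (lqs _ dl)).
  have [o0 [o0d ud peak below]] := top _ dl.
  move: (o0d); rewrite darts_shift => /mapP[o1 o1D def_o0].
  have uD : uniq (darts 1 s) by move: ud; rewrite darts_shift; apply: map_uniq.
  move: pl; rewrite def_l pairwise_cat /= => /and3P[/allrelP ltl1 _ /andP[/allP ltd pl2]].
  (* This cochain lives on the class of the top edge of [d]; since [o1] is [o0] seen from base point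
     1, the factor [o1.1.1^-1] leads from the edge back to the base point of its cell. *)
  pose c (e : F * F) := (((e.2 == o1.1.2) && equivalent le e.1 o0.1.1)%:R
    * chi' (e.1 * o1.1.1^-1)%g)%R.
  have ci : invariant_cochain ET le c.
    move=> f g x fx gx fg Sfg; rewrite /c /= (equivalent_left ale _ fg).
    congr (_ * _)%R; rewrite -(chi'S (f * _) ((f^-1 * g) ^ (o1.1.1^-1))); last exact: nS.2.
    by rewrite conjgE invgK !mulgA mulgVK mulgV mul1g.
  have along q d' o : walk_in (fun e => e \in ET) (darts q s) -> d' \in l ->
      o \in darts 1 s -> equivalent le q d' -> equivalent le (q * o.1.1) (d' * o.1.1).
    move=> qs d'l oD qd'; have d'e := qs_edges m_gt0 qs_in (lqs _ d'l).
    by rewrite /equivalent !(le_along_dart ale _ _ oD).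
  (* The contribution of the classes above [d], already known to vanish under [Phi]. By [peak] the
     class of [d] contributes a single term, and by [below] the lower classes contribute none. *)
  pose g q := (\sum_(d' <- l2) \sum_(o <- darts 1 s)
    (bsign o.2 * ((o.1.2 == o1.1.2) && equivalent le (d' * o.1.1)%g o0.1.1)%:R) *
      ((equivalent le q d')%:R * chi' (q * (o.1.1 * o1.1.1^-1))%g))%R.
  have Phi_g : Phi g = 0%R.
    apply: (Phi_sum) => d' d'l2; apply: (Phi_sum) => o _.
    rewrite PhiZ (IH d' d'l2 (fun q => chi' (q * (o.1.1 * o1.1.1^-1)))) ?mulr0 // => f z Sz.
    move: (o.1.1 * _) => v; rewrite -(chi'S (f * v) (z ^ v)); last exact: nS.2.
    by rewrite conjgE !mulgA mulgK.
  have walk_c : forall q, walk_in (fun e => e \in ET) (darts q s) ->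
      forall d', d' \in l -> equivalent le q d' ->
      wsum c (darts q s) = (bsign o1.2 * ((equivalent le q d)%:R * chi' q) + g q)%R.
    move=> q qs d' d'l qd'; rewrite walk_shift /c /=.
    have lt_ne x y : ~~ le x y -> equivalent le x y = false.
      by move=> /negbTE xy; rewrite /equivalent xy.
    have lt_ne' x y : ~~ le x y -> equivalent le y x = false.
      by move=> /negbTE xy; rewrite /equivalent xy andbF.
    rewrite (eq1 _ _ _ qd').
    have ueq o : o \in darts 1 s ->
        equivalent le (q * o.1.1) o0.1.1 = equivalent le (d' * o.1.1) o0.1.1.
      by move=> oD; apply: (equivalent_left ale); apply: along.
    move: (d'l); rewrite {1}def_l mem_cat inE => /or3P[d'l1|/eqP ed|d'l2].
    - rewrite (lt_ne' d d') ?mul0r ?mulr0 ?add0r; last by apply: (ltl1 d' d) => //; apply: mem_head.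
      rewrite big1_seq => [|o /andP[_ oD]].
        rewrite /g big1_seq // => d2 /andP[_ d2l2]; apply: big1 => o _.
        rewrite (eq1 _ _ _ qd') (lt_ne' d2 d') ?mul0r ?mulr0 //.
        by apply: (ltl1 d' d2) => //; rewrite inE d2l2 orbT.
      have [ox|] := eqVneq o.1.2 o1.1.2; last by rewrite mul0r mulr0.
      rewrite ueq // lt_ne' ?mul0r ?mulr0 //.
      apply: (below d' (d' * o.1.1, o.1.2, o.2)) => //.
      + by apply: (ltl1 d' d) => //; apply: mem_head.
      + by rewrite (darts_shift d'); apply: map_f.
      + by rewrite def_o0.
    - subst d'; rewrite eqd mul1r.
      rewrite [X in (_ + X)%R]big1_seq ?addr0; last first.
        move=> d2 /andP[_ d2l2]; apply: big1 => o _.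
        by rewrite (eq1 _ _ _ qd') (lt_ne' d2 d) ?mul0r ?mulr0 //; apply: ltd.
      rewrite (bigD1_seq o1) //= big1_seq ?addr0; last first.
        move=> o /andP[oo1 oD]; have [ox|] := eqVneq o.1.2 o1.1.2; last by rewrite mul0r mulr0.
        rewrite ueq //; case: (boolP (equivalent _ _ _)) => [eo|]; last by rewrite mul0r mulr0.
        case/eqP: oo1; have : (d * o.1.1, o.1.2, o.2) = o0.
          apply: peak => //; last by rewrite def_o0.
          by rewrite (darts_shift d); apply: map_f.
        by rewrite def_o0 => -[/mulgI]; case: (o) (o1) => [[? ?] ?] [[? ?] ?] /= -> -> ->.
      by rewrite eqxx ueq // def_o0 /= eqd mul1r mulgK.
    rewrite (lt_ne d' d) ?mul0r ?mulr0 ?add0r; last exact: ltd.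
    have ul2 : uniq l2.
      by apply: pairwise_uniq pl2 => x; apply/negbTE/ltl.
    rewrite /g (bigD1_seq d') //= [X in (_ + X)%R]big1_seq ?addr0; last first.
      move=> d2 /andP[nd d2l2]; apply: big1 => o _; rewrite (eq1 _ _ _ qd').
      suff -> : equivalent le d' d2 = false by rewrite mul0r mulr0.
      apply: contraNF nd => dd2; apply/eqP; move: d'l2 d2l2 pl2 dd2.
      rewrite /equivalent; elim: (l2) => // x r IHr; rewrite !inE /=.
      move=> /predU1P[->|d'r] /predU1P[->|d2r] /andP[/allP xr pr] // /andP[h1 h2].
      + by have := xr _ d2r; rewrite h2.
      + by have := xr _ d'r; rewrite h1.
      by apply: IHr; rewrite ?h1 ?h2.
    apply: eq_big_seq => o oD; rewrite (eq1 _ _ _ qd') eqd mul1r ueq // !mulgA.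
    by rewrite mulrA.
  have := Phi_walk c ci; rewrite (eq_Phi _ _ walk_c) PhiD Phi_g addr0 PhiZ => /eqP.
  by rewrite mulf_eq0 => /orP[|/eqP->//]; rewrite /bsign; case: o1.2.
have Phi0 : Phi chi = 0%R.
  rewrite (eq_Phi _ (fun q => \sum_(d <- l) (equivalent le q d)%:R * chi q)%R).
    by apply: (Phi_sum) => d dl; apply: (claim l [::]).
  move=> q _ d dl qd.
  have ul : uniq l by apply: pairwise_uniq pl => x; apply/negbTE/ltl.
  rewrite (bigD1_seq d) //= qd mul1r big1_seq ?addr0 // => d2 /andP[nd d2l].
  suff -> : equivalent le q d2 = false by rewrite mul0r.
  rewrite (eq1 _ _ _ qd); apply: contraNF nd => dd2; apply/eqP; move: dl d2l pl dd2.
  rewrite /equivalent; elim: (l) => // x r IHr; rewrite !inE /=.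
  move=> /predU1P[->|d'r] /predU1P[->|d2r] /andP[/allP xr pr] // /andP[h1 h2].
  + by have := xr _ d2r; rewrite h2.
  + by have := xr _ d'r; rewrite h1.
  by apply: IHr; rewrite ?h1 ?h2.
have S1 : S 1 by case/subgroupP: nS.1.
rewrite -(identity_cells_sum _ S1 chiS); apply/eqP.
(* Invariance of [chi] under [sigma] turns the [m] lifts of a cell into a factor [m], which is
   nonzero in [rat]. *)
have /eqP := Phi0; rewrite /Phi (eq_bigr (fun e => m%:R * (e.1 * chi e.2)))%R; last first.
  move=> e _; rewrite (eq_bigr (fun=> chi e.2)) => [|j _]; last first.
    by elim: (nat_of_ord j) => [|k IH]; rewrite ?expg0 ?mulg1 // expgSr mulgA chis.
  by rewrite sumr_const card_ord mulrnAr mulr_natl.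
rewrite -mulr_sumr mulf_eq0 pnatr_eq0 => /orP[/eqP m0|//].
by move: m_gt0; rewrite m0.
Qed.

End Identities.

(** * Roots and cyclically reduced words *)

Lemma commuting_words (T : eqType) (u v : seq T) : u ++ v = v ++ u ->
  exists z i j, u = flatten (nseq i z) /\ v = flatten (nseq j z).
Proof.
have [n] := ubnP (size u + size v)%N; elim: n u v => // n IH u v.
wlog uv : u v / (size u <= size v)%N => [W|] lt e.
  case: (leqP (size u) (size v)) => [/W|/ltnW vu]; first exact.
  by have [||z [i [j [-> ->]]]] := W _ _ vu; rewrite 1?addnC //; exists z, j, i.
case: u uv lt e => [|x u] uv lt e; first by exists v, 0%N, 1%N; rewrite /= cats0.
have ev : v = (x :: u) ++ drop (size (x :: u)) v.
  have h : x :: u = take (size (x :: u)) v.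
    by have := congr1 (take (size (x :: u))) e; rewrite take_size_cat // takel_cat.
  by rewrite {1}h cat_take_drop.
move: ev e lt uv; set v' := drop _ _ => -> e lt _.
have e' : (x :: u) ++ v' = v' ++ x :: u.
  by move: e; rewrite -catA => /eqP; rewrite eqseq_cat // eqxx => /eqP.
have [|z [i [j [eu ev]]]] := IH (x :: u) v' _ e'.
  by move: lt; rewrite size_cat /=; lia.
by exists z, i, (i + j)%N; rewrite nseqD flatten_cat -eu -ev.
Qed.

Lemma not_path (T : Type) (e : rel T) x p : ~~ path e x p ->
  exists p1 y z p2, x :: p = p1 ++ y :: z :: p2 /\ ~~ e y z.
Proof.
elim: p x => // y p IH x /=; rewrite negb_and => /orP[nxy|/IH[p1 [y' [z [p2 [-> nyz]]]]]].
  by exists [::], x, y, p.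
by exists (x :: p1), y', z, p2.
Qed.

Section CyclicNormalForm.
Variables (F : groupType) (B : set F).
Hypothesis hB : free_basis B.

Lemma letter_inv_neq (l : F * bool) : letter_inv l != l.
Proof. by apply/eqP; case: l => x []. Qed.

(** Take the shortest word having a positive power conjugate to [r]. A cyclic cancellation would
    shorten it; a nontrivial rotation fixing it would split it into two commuting words, hence make
    it a proper power of a shorter word. *)
Lemma primitive_root_form (r : F) : r <> 1 -> exists a s' m g,
  [/\ (0 < m)%N, word_over B (a :: s'), cycle (@reduced_letters F) (a :: s'),
      primitive (a :: s') & r = g * word_val (a :: s') ^+ m * g^-1].
Proof.
move=> r1.
pose P n := `[< exists s m g, [/\ size s = n, word_over B s, (0 < m)%N &
  r = g * word_val s ^+ m * g^-1] >].
have exP : exists n, P n.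
  have [w [wB ew]] := word_exists hB r; exists (size w); apply/asboolP.
  by exists w, 1%N, 1; rewrite ew expg1 invg1 mulg1 mul1g.
case: (ex_minnP exP) => _ /asboolP[s [m [g [<- sB m0 er]]]] min.
have shorter t k h : word_over B t -> (0 < k)%N -> r = h * word_val t ^+ k * h^-1 ->
    (size s <= size t)%N.
  by move=> tB k0 e; apply: min; apply/asboolP; exists t, k, h.
case: s sB er {min} shorter => [|a s'] sB er shorter.
  by case: r1; rewrite er /= expg1n mulg1 mulgV.
exists a, s', m, g; split=> //.
  apply: contrapT => /negP np.
  have [p1 [y [z [p2 [e]]]]] := @not_path _ (@reduced_letters F) a (rcons s' a) np.
  rewrite negbK => /eqP yz; case/lastP: p2 e => [|p2 z'] e.
    (* Cancellation at the wrap-around: deleting the last and first letters conjugates by the first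
       one. *)
    have : rcons (a :: s') a = rcons (rcons p1 y) z by rewrite -[RHS]cats1 cat_rcons -e.
    move=> /rcons_inj[e1 ez]; case: p1 e1 {e} => [[ea _]|b t /= [eb es']].
      by have := letter_inv_neq y; rewrite -yz -ez ea eqxx.
    have tB : word_over B t.
      by move=> l lt; apply: sB; rewrite es' inE mem_rcons inE lt !orbT.
    have := shorter t m (g * letter_val a) tB m0.
    rewrite es' /= size_rcons ltnNge leqnSn => h.
    have /h : r = g * letter_val a * word_val t ^+ m * (g * letter_val a)^-1; last by [].
    rewrite er es' /= -cats1 word_val_cat /= mulg1.
    have -> : letter_val y = (letter_val a)^-1 by rewrite ez yz letter_val_inv invgK.
    rewrite (_ : _ * (_ / _) = word_val t ^ (letter_val a)^-1); last by rewrite conjgE invgK.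
    by rewrite -conjXg conjgE invgK invgM !mulgA.
  have es : a :: s' = p1 ++ y :: z :: p2.
    have : rcons (a :: s') a = rcons (p1 ++ y :: z :: p2) z' by rewrite rcons_cat /= -e.
    by move=> /rcons_inj[].
  have tB : word_over B (p1 ++ p2).
    move=> l; rewrite mem_cat => /orP lp; apply: sB; rewrite es mem_cat !inE.
    by case: lp => ->; rewrite ?orbT.
  have := shorter (p1 ++ p2) m g tB m0.
  rewrite es !size_cat /= !addnS [(_.+1 < _)%N]ltnNge leqnSn => h.
  have /h : r = g * word_val (p1 ++ p2) ^+ m * g^-1; last by [].
  by rewrite er es !word_val_cat /= yz letter_val_inv mulVKg.
move=> n nn; apply/eqP => rn.
have [z [i [j [eu ev]]]] : exists z i j, take n (a :: s') = flatten (nseq i z) /\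
    drop n (a :: s') = flatten (nseq j z).
  by apply: commuting_words; rewrite cat_take_drop -[RHS]/(rot n (a :: s')) rn.
have es : a :: s' = flatten (nseq (i + j) z).
  by rewrite nseqD flatten_cat -eu -ev cat_take_drop.
have size_pow k : size (flatten (nseq k z)) = (k * size z)%N.
  by elim: k => //= k IH; rewrite size_cat IH mulSn.
have /andP[n0 ns] := nn.
have i0 : (0 < i * size z)%N by rewrite -size_pow -eu size_take ns.
have j0 : (0 < j * size z)%N by rewrite -size_pow -ev size_drop subn_gt0.
have := shorter z ((i + j) * m)%N g; rewrite expgnA -word_val_nseq -es => h.
suff : (size (a :: s') <= size z)%N.
  rewrite es size_pow leqNgt => /negP; apply.
  move: (i0); rewrite muln_gt0 => /andP[i1 _].
  by rewrite mulnDl -addn1; apply: leq_add; first by rewrite leq_pmull.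
apply: h => //; last by rewrite muln_gt0 m0 andbT addn_gt0; move: i0; rewrite muln_gt0 => /andP[->].
move=> l lz; apply: sB; rewrite es; case: (i) i0 => // k _.
by rewrite /= mem_cat lz.
Qed.

End CyclicNormalForm.

(** * The relation module of one relator *)

Lemma collect_modulo_commutator (G : groupType) (t c1 t' c2 : G) :
  t * (c1 * (t' * c2)) = (c1 * c2) * ((t * t') * ([~ t, c1] ^ t')) ^ c2.
Proof. by rewrite !conjgE /commg /conjg !mulgA !mulgK mulgV mul1g. Qed.

Section RelationModule.
Variables (F : groupType) (r : F).
Local Notation R := (normal_closure r).
Implicit Types (L : seq (bool * F)).

Lemma normal_closure_gen : R r.
Proof. by move=> N [_ rN]; apply: rN. Qed.

Lemma conj_prod_cat L L' : conj_prod r (L ++ L') = conj_prod r L * conj_prod r L'.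
Proof. by elim: L => [|p L IH] /=; rewrite ?mul1g // IH mulgA. Qed.

Lemma conj_term_conjg (p : bool * F) (y : F) :
  conj_term r (p.1, y^-1 * p.2) = conj_term r p ^ y.
Proof. by rewrite /conj_term conjgE /= invgM invgK !mulgA. Qed.

Lemma conj_term_inv (p : bool * F) : conj_term r (~~ p.1, p.2) = (conj_term r p)^-1.
Proof. by rewrite /conj_term /= !invgM invgK mulgA; case: p.1; rewrite ?invgK. Qed.

Lemma conj_prod_conjg L y :
  conj_prod r [seq (p.1, y^-1 * p.2) | p <- L] = conj_prod r L ^ y.
Proof.
by elim: L => [|p L IH] /=; rewrite ?conj1g // IH conj_term_conjg conjMg.
Qed.

Lemma conj_prod_inv L :
  conj_prod r (rev [seq (~~ p.1, p.2) | p <- L]) = (conj_prod r L)^-1.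
Proof.
elim: L => [|p L IH]; first by rewrite /= invg1.
by rewrite /= rev_cons -cats1 conj_prod_cat IH /= conj_term_inv mulg1 [in RHS]invgM.
Qed.

Lemma normal_closure_prod x : R x -> exists L, x = conj_prod r L.
Proof.
move=> Rx; apply: (Rx [set y | exists L, y = conj_prod r L]); split=> [|_ ->]; last first.
  by exists [:: (true, 1)]; rewrite /= /conj_term /= invg1 !mulg1 mul1g.
split=> [|z y [L ->]]; last first.
  by exists [seq (p.1, y^-1 * p.2) | p <- L]; rewrite conj_prod_conjg.
apply/subgroupP; split=> [|z y [L ->] [L' ->]]; first by exists [::].
by exists (L ++ rev [seq (~~ p.1, p.2) | p <- L']); rewrite conj_prod_cat conj_prod_inv.
Qed.

Lemma normal_closure_term (p : bool * F) : R (conj_term r p).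
Proof.
have [sR nR] := normal_normal_closure r; have Rr := normal_closure_gen.
have : R (if p.1 then r else r^-1) by case: p.1 => //; exact: subgroupV sR Rr.
by move=> /(nR _ (p.2^-1)); rewrite conjgE invgK /conj_term mulgA.
Qed.

Lemma conj_prod_in L : R (conj_prod r L).
Proof.
have [sR _] := normal_normal_closure r.
elim: L => [|p L IH] /=; first by case/subgroupP: sR.
exact: subgroupM sR (normal_closure_term p) IH.
Qed.

Variables (B : set F).
Hypothesis hB : free_basis B.
Variable S : set F.
Hypotheses (nS : normal_subgroup S) (RS : R `<=` S).
Local Notation N := (commutator R S).

Let nN : normal_subgroup N := normal_commutator (normal_normal_closure r) nS.
Let sN : subgroup N := nN.1.

Lemma commutator_mem (A A' : set F) x y : A x -> A' y -> commutator A A' [~ x, y].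
Proof. by move=> Ax Ay H [_]; apply; exists x, y. Qed.

(** For the action of [F] on [R] modulo [N] by conjugation, this is the stabiliser of the class of
    [r]; its left cosets index the conjugates of [r] modulo [N]. *)
Definition stabiliser : set F := [set h | N (h * r * h^-1 * r^-1)].

Lemma subgroup_stabiliser : subgroup stabiliser.
Proof.
apply/subgroupP; split=> [|x y hx hy]; rewrite /stabiliser /=.
  by rewrite invg1 mulg1 mul1g mulgV; case/subgroupP: sN.
have hy' : N (y^-1 * r * y * r^-1).
  have := subgroupV sN (nN.2 _ y hy); suff -> : ((y * r / y / r) ^ y)^-1 = y^-1 * r * y / r by [].
  by rewrite conjgE !invgM !invgK !mulgA mulgVK.
suff -> : x / y * r / (x / y) / r = (y^-1 * r * y / r) ^ x^-1 * (x * r / x / r).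
  exact: subgroupM sN (nN.2 _ _ hy') hx.
by rewrite conjgE !invgM !invgK !mulgA !mulgVK.
Qed.

Definition left_coset (f : F) : set F := [set g | stabiliser (f^-1 * g)].

Lemma left_coset_eq f g : left_coset f = left_coset g <-> stabiliser (f^-1 * g).
Proof.
have sH := subgroup_stabiliser; split=> [e|fg].
  have : left_coset g g by rewrite /left_coset /= mulVg; case/subgroupP: sH.
  by rewrite -e.
apply/seteqP; split=> h /= hh.
  have := subgroupM sH (subgroupV sH fg) hh.
  by rewrite invgM invgK mulgA mulgK.
by have := subgroupM sH fg hh; rewrite mulgA mulgK.
Qed.

Lemma stabiliser_sub z : S z -> stabiliser z.
Proof.
move=> Sz; rewrite /stabiliser /=.
have -> : z * r / z / r = [~ r^-1, z^-1]^-1.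
  by rewrite invgR /commg conjgE !invgK !mulgA.
apply: subgroupV sN _; apply: commutator_mem; last exact: subgroupV nS.1 Sz.
exact: subgroupV (normal_normal_closure r).1 normal_closure_gen.
Qed.

Lemma left_cosetM f z : stabiliser z -> left_coset (f * z) = left_coset f.
Proof.
move=> hz; apply/left_coset_eq; rewrite invgM mulgVK.
exact: subgroupV subgroup_stabiliser hz.
Qed.

Definition class_sum L : {freeg (set F)} :=
  (\sum_(p <- L) << (if p.1 then 1 else -1) *g left_coset p.2 >>)%R.

Lemma class_sum_cat L L' : class_sum (L ++ L') = (class_sum L + class_sum L')%R.
Proof. exact: big_cat. Qed.

Lemma class_sum_inv L : class_sum (rev [seq (~~ p.1, p.2) | p <- L]) = (- class_sum L)%R.
Proof.
rewrite /class_sum big_rev /= big_map -sumrN; apply: eq_bigr => p _ /=.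
by rewrite freegUN; case: p.1; rewrite ?opprK.
Qed.

Lemma class_sum_eq0 L : r <> 1 -> conj_prod r L = 1 -> class_sum L = 0%R.
Proof.
move=> r1 L1; have [a [s' [m [g [m0 sB s_red s_prim er]]]]] := primitive_root_form hB r1.
set sigma := word_val (a :: s') in er.
have Rr := normal_closure_gen.
have Ssig : S (sigma ^+ m).
  have := nS.2 _ g (RS Rr); rewrite er conjgE !mulgA mulVg mul1g mulgVK //.
have [wd wdP] := choice (word_exists hB).
(* Conjugating [r] by u is conjugating [sigma ^+ m] by u g; the factor [g^-1] in [chi] below undoes
   this shift. *)
have L1' : conj_prod (sigma ^+ m) [seq (p.1, p.2 * g) | p <- L] = 1.
  rewrite -L1; elim: (L) => //= p L' ->; congr (_ * _).
  rewrite /conj_term /= invgM !mulgA; congr (_ * _); rewrite -!mulgA; congr (_ * _).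
  by rewrite er; case: p.1; rewrite ?invgM ?invgK !mulgA.
have hsig : stabiliser (g * sigma * g^-1).
  have -> : g * sigma * g^-1 = sigma ^ (g^-1) by rewrite conjgE invgK -mulgA.
  have er' : r = (sigma ^ (g^-1)) ^+ m by rewrite -conjXg conjgE invgK er -mulgA.
  have comm : commute (sigma ^ (g^-1)) r by rewrite er'; apply: commuteX.
  by rewrite /stabiliser /= comm mulgK mulgV; case/subgroupP: sN.
apply/eqP/freeg_eqP => v; rewrite coeff0.
pose chi f : rat := (left_coset (f * g^-1) == v)%:R%R.
have := @identity_theorem_word F B hB a s' m S m0 sB s_red s_prim nS Ssig wd
  (fun u => (wdP u).1) (fun u => (wdP u).2) _ chi L1'.
have chiS f z : S z -> chi (f * z) = chi f.
  move=> Sz; rewrite /chi -(@left_cosetM (f / g) (z ^ (g^-1))); last first.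
    by apply: stabiliser_sub; apply: nS.2.
  by rewrite conjgE !invgK !mulgA mulgVK.
have chis f : chi (f * sigma) = chi f.
  by rewrite /chi -(left_cosetM (f / g) hsig) !mulgA mulgVK.
move=> /(_ chiS chis); rewrite big_map => e; apply/eqP.
rewrite -(intr_eq0 rat) /class_sum raddf_sum rmorph_sum -[X in _ == X]e; apply/eqP.
apply: eq_bigr => p _ /=; rewrite coeffU rmorphM /bsign /chi mulgK.
by case: p.1; case: (_ == v).
Qed.

(** The first term must meet one of opposite sign in the same coset, and these two are inverse
    modulo [N]. As [R] lies in [S], elements of [R] commute modulo [N], so the pair can be brought
    together and removed. *)
Lemma class_sum_ker L : class_sum L = 0%R -> N (conj_prod r L).
Proof.
have [sR nR] := normal_normal_closure r; have nN2 := nN.2.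
have [n] := ubnP (size L); elim: n L => // n IH [_ _|[b u] L].
  by case/subgroupP: sN.
rewrite ltnS /= => sL; rewrite /class_sum big_cons -/(class_sum L) /= => e.
have [L1 [u' [L2 [def_L eu]]]] : exists L1 u' L2,
    L = L1 ++ (~~ b, u') :: L2 /\ left_coset u = left_coset u'.
  have [/hasP[[b' u'] pL /andP[/= /eqP b'b /eqP eu]]|nh] :=
      boolP (has (fun p => (p.1 == ~~ b) && (left_coset p.2 == left_coset u)) L).
    by case/splitPr: pL => L1 L2; exists L1, u', L2; rewrite b'b eu.
  (* Otherwise every term in the coset of [u] has the sign of [b], and its coefficient in the whole
     sum cannot vanish. *)
  exfalso; pose sg (b : bool) : int := if b then 1%R else (-1)%R.
  have cu : coeff (left_coset u) (class_sum L) = (- sg b)%R.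
    move/eqP: e; rewrite addrC addr_eq0 => /eqP ->.
    by rewrite coeffN coeffU eqxx mulr1.
  suff : (0 <= sg b * coeff (left_coset u) (class_sum L))%R.
    by rewrite cu /sg; case: (b).
  rewrite /class_sum raddf_sum mulr_sumr big_seq; apply: sumr_ge0 => p pL.
  rewrite /= coeffU; have := hasPn nh _ pL; rewrite negb_and.
  by rewrite /sg; case: (left_coset p.2 == _); case: p.1; case: (b).
set t := conj_term r (b, u); set t' := conj_term r (~~ b, u').
have tt' : N (t * t').
  have hu : stabiliser (u'^-1 * u) by apply/left_coset_eq.
  have hx : N (u'^-1 * u * r * (u'^-1 * u)^-1 * r^-1) := hu.
  have hx' : N (u'^-1 * u * r^-1 * (u'^-1 * u)^-1 * r).
    have := nN2 _ r (subgroupV sN hx); suff -> : (u'^-1 * u * r / (u'^-1 * u) / r)^-1 ^ r =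
      u'^-1 * u * r^-1 * (u'^-1 * u)^-1 * r by [].
    by rewrite conjgE !invgM !invgK !mulgA mulVg mul1g.
  have Ny : N (u'^-1 * u * (if b then r else r^-1) * (u'^-1 * u)^-1
      * (if ~~ b then r else r^-1)) by case: (b).
  have := nN2 _ u'^-1 Ny; rewrite conjgE invgK invgM invgK !mulgA mulgV mul1g.
  by rewrite /t /t' /conj_term /= ?mulgA.
rewrite def_L conj_prod_cat /= -/t -/t'.
have IH' : N (conj_prod r (L1 ++ L2)).
  apply: IH; first by apply: leq_trans sL; rewrite def_L !size_cat /= addnS ltnS.
  apply/eqP; rewrite -e def_L !class_sum_cat /class_sum big_cons /= -eu.
  rewrite [X in _ == X]addrCA [X in (_ == _ + X)%R]addrA freegUD.
  by case: (b); rewrite ?subrr ?addNr freegU0 add0r.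
set c1 := conj_prod r L1; set c2 := conj_prod r L2.
rewrite collect_modulo_commutator.
rewrite conj_prod_cat in IH'; apply: (subgroupM sN IH'); apply: (nN.2).
apply: (subgroupM sN tt'); apply: (nN.2); apply: commutator_mem.
  exact: normal_closure_term.
by apply: RS; apply: conj_prod_in.
Qed.

Lemma relation_hom : exists lam : F -> {freeg (set F)},
  (forall x y, R x -> R y -> lam (x * y) = (lam x + lam y)%R) /\
  (forall x, R x -> lam x = 0%R <-> N x).
Proof.
have [r1|r1] := pselect (r = 1).
  (* For r = 1 a class sum would count trivial conjugates and is not determined by the product; but
     [R] is then trivial. *)
  exists (fun=> 0%R); split=> [x y _ _|x Rx]; first by rewrite addr0.
  split=> // _.
  have -> : x = 1.
    apply: (Rx [set 1]); split=> [|_ ->] //; split=> [|y z ->]; last by rewrite conj1g.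
    by apply/subgroupP; split=> // y z -> ->; rewrite divgg.
  by case/subgroupP: sN.
pose expr x := if pselect (R x) is left Rx then projT1 (cid (normal_closure_prod Rx)) else [::].
have exprE x : R x -> conj_prod r (expr x) = x.
  rewrite /expr; case: pselect => // Rx _; by case: cid.
have wd L L' : conj_prod r L = conj_prod r L' -> class_sum L = class_sum L'.
  move=> e; apply/eqP; rewrite -subr_eq0 -class_sum_inv -class_sum_cat; apply/eqP.
  by apply: class_sum_eq0 => //; rewrite conj_prod_cat conj_prod_inv e mulgV.
have [sR nR] := normal_normal_closure r.
pose lam x := class_sum (expr x).
have lamM x y : R x -> R y -> lam (x * y) = (lam x + lam y)%R.
  move=> Rx Ry; rewrite -class_sum_cat; apply: wd.
  by rewrite conj_prod_cat !exprE //; apply: subgroupM sR Rx Ry.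
have lam1 : lam 1 = 0%R.
  have R1 : R 1 by case/subgroupP: sR.
  by apply: (addrI (lam 1)); rewrite -lamM // mulg1 addr0.
have lamV x : R x -> lam x^-1 = (- lam x)%R.
  move=> Rx; apply/eqP; rewrite -addr_eq0 -lamM ?mulVg ?lam1 //.
  exact: subgroupV sR Rx.
have lamJ x s : R x -> S s -> lam (x ^ s) = lam x.
  move=> Rx Ss; have -> : lam (x ^ s) = class_sum [seq (p.1, s^-1 * p.2) | p <- expr x].
    by apply: wd; rewrite conj_prod_conjg !exprE //; apply: nR.
  rewrite /lam /class_sum big_map; apply: eq_bigr => p _ /=.
  rewrite -[s^-1 * _](mulVKg p.2) left_cosetM //; apply: stabiliser_sub.
  by rewrite -conjgE; apply: nS.2; apply: subgroupV nS.1 Ss.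
exists lam; split=> // x Rx; split=> [lx|].
  by rewrite -(exprE x Rx); apply: class_sum_ker.
pose X := [set x | R x /\ lam x = 0%R].
suff /(_ x) XN : N `<=` X by move=> /XN[].
have sX : subgroup X.
  apply/subgroupP; split=> [|y z [Ry ly] [Rz lz]]; first by split=> //; case/subgroupP: sR.
  have Rz' := subgroupV sR Rz; split; first exact: subgroupM sR Ry Rz'.
  by rewrite lamM // lamV // ly lz subrr.
move=> z; apply; split=> // _ [y [s [Ry Ss ->]]].
have Ry' := subgroupV sR Ry.
have RyJ : R (y ^ s) by apply: nR.
by split; rewrite commgEl; [apply: subgroupM sR Ry' RyJ|rewrite lamM // lamV // lamJ // addNr].
Qed.

End RelationModule.

(** * The intersection of [R1, S] and [R2, S] *)

Section Products.
Variable G : groupType.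
Implicit Types A N : set G.

Definition set_product A N : set G := [set z | exists x y, [/\ A x, N y & z = x * y]].

Lemma subgroup1 A : subgroup A -> A 1.
Proof. by case/subgroupP. Qed.

Lemma normal_conjV A x y : normal_subgroup A -> A (x ^ y) -> A x.
Proof. by move=> nA Axy; rewrite -[x](conjgK y); apply: nA.2. Qed.

Lemma normal_product A N : normal_subgroup A -> normal_subgroup N ->
  normal_subgroup (set_product A N).
Proof.
move=> nA nN; split=> [|_ z [x [y [Ax Ny ->]]]]; last first.
  by exists (x ^ z), (y ^ z); split; [exact: nA.2|exact: nN.2|rewrite conjMg].
apply/subgroupP; split.
  by exists 1, 1; split; [exact: subgroup1 nA.1|exact: subgroup1 nN.1|rewrite mulg1].
move=> _ _ [x [y [Ax Ny ->]]] [x' [y' [Ax' Ny' ->]]].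
exists (x * x'^-1), ((y / y') ^ x'^-1); split.
- exact: subgroupM nA.1 Ax (subgroupV nA.1 Ax').
- exact: nN.2 (subgroupM nN.1 Ny (subgroupV nN.1 Ny')).
by rewrite conjgE invgM invgK !mulgA mulgVK.
Qed.

Lemma product_left A N : subgroup N -> A `<=` set_product A N.
Proof. by move=> sN x Ax; exists x, 1; split; rewrite ?mulg1 //; apply: subgroup1. Qed.

Lemma product_right A N : subgroup A -> N `<=` set_product A N.
Proof. by move=> sA x Nx; exists 1, x; split; rewrite ?mul1g //; apply: subgroup1. Qed.

Lemma commutator_sub A A' (H : set G) : subgroup H ->
  (forall x y, A x -> A' y -> H [~ x, y]) -> commutator A A' `<=` H.
Proof. by move=> sH AH z; apply; split=> // _ [x [y [Ax Ay ->]]]; apply: AH. Qed.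

Lemma commgM (x y z : G) : [~ x, y * z] = [~ x, z] * [~ x, y] ^ z.
Proof. by rewrite /commg /conjg invgM !mulgA !mulgK. Qed.

Lemma commMg (x y z : G) : [~ x * y, z] = [~ x, z] ^ y * [~ y, z].
Proof. by rewrite /commg /conjg !invgM !mulgA !mulgK. Qed.

End Products.

Section Lift.
Variables (F : groupType) (B : set F).
Hypothesis hB : free_basis B.
Variables (R1 R2 : set F).
Hypotheses (nR1 : normal_subgroup R1) (nR2 : normal_subgroup R2).
Local Notation S := (set_product R1 R2).
Let nS : normal_subgroup S := normal_product nR1 nR2.

(* Subgroups of free groups are projective: the isomorphism of S / R2 with
   R1 / (R1 `&` R2) lifts to a morphism from S to R1. It is the restriction to S of
   a map that is determined on F by its increments along a transversal of S. *)
Lemma projective_lift : exists phi : F -> F,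
  [/\ forall x, S x -> R1 (phi x), forall x y, S x -> S y -> phi (x * y) = phi x * phi y
    & forall x, S x -> R2 (x^-1 * phi x)].
Proof.
have sS := nS.1.
(* A transversal of the cosets of [S], normalised to 1 on [S] itself. *)
pose t f := if `[< S f >] then 1 else choose (fun g => `[< S (g * f^-1) >]) f.
have tS f : S (t f * f^-1).
  rewrite /t; case: asboolP => Sf; first by rewrite mul1g; apply: subgroupV sS Sf.
  apply/asboolP; apply: (@chooseP _ (fun g => `[< S (g * f^-1) >])).
  by apply/asboolP; rewrite mulgV; apply: subgroup1.
have tM s f : S s -> t (s * f) = t f.
  move=> Ss; have Ssf : S (s * f) <-> S f.
    split=> h; last exact: subgroupM sS Ss h.
    by rewrite -(mulKg s f); apply: subgroupM sS (subgroupV sS Ss) h.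
  rewrite /t; case: (asboolP (S f)) => Sf; first by rewrite asboolT //; apply/Ssf.
  rewrite asboolF => [|/Ssf//].
  rewrite (@eq_choose _ _ (fun g => `[< S (g * f^-1) >])) => [|g].
    apply: choose_id; apply/asboolP; last by rewrite mulgV; apply: subgroup1.
    by rewrite mulgK.
  apply/asboolP/asboolP; rewrite invgM mulgA => h.
    by have := subgroupM sS h Ss; rewrite mulgVK.
  exact: subgroupM sS h (subgroupV sS Ss).
(* A lift to [R1] on elements only; no multiplicativity is available yet. *)
have [q qP] : exists q, forall z, S z -> R1 (q z) /\ R2 (z^-1 * q z).
  have : forall z, exists x, S z -> R1 x /\ R2 (z^-1 * x).
    move=> z; have [[x [y [Rx Ry ->]]]|nSz] := pselect (S z); last by exists 1.
    exists x => _; split=> //; rewrite invgM mulgVK; exact: subgroupV nR2.1 Ry.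
  by move=> H; have [q qP] := choice H; exists q.
(* These are the Schreier generators of [S]. They do not change when [f] is multiplied on the left
   by [S], which makes [h] multiplicative for left factors in [S]. *)
pose inc f x := t f * x * (t (f * x))^-1.
have incS f x : S (inc f x).
  have := subgroupM sS (tS f) (subgroupV sS (tS (f * x))).
  by rewrite invgM invgK !mulgA mulgVK.
have [h h1 hM] := free_recursion hB (1 : F)
  (s := fun f x y => y * q (inc f x)) (s' := fun f x y => y * (q (inc f x))^-1)
  (fun f x y => mulgK _ _) (fun f x y => mulgVK _ _).
have hV f x : B x -> h (f / x) = h f * (q (inc (f / x) x))^-1.
  by move=> Bx; have := hM (f / x) x Bx; rewrite mulgVK => ->; rewrite mulgK.
have hR1 f : R1 (h f).
  elim/(basis_ind hB): f => [|f x Bx IH|f x Bx IH]; first by rewrite h1; apply: subgroup1 nR1.1.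
    by rewrite hM //; apply: subgroupM nR1.1 IH (qP _ (incS _ _)).1.
  by rewrite hV //; apply: subgroupM nR1.1 IH (subgroupV nR1.1 (qP _ (incS _ _)).1).
have inc_left s f x : S s -> inc (s * f) x = inc f x.
  by move=> Ss; rewrite /inc -[s * f * x]mulgA !(tM s) //.
have hS s f : S s -> h (s * f) = h s * h f.
  move=> Ss; elim/(basis_ind hB): f => [|f x Bx IH|f x Bx IH].
  - by rewrite h1 !mulg1.
  - by rewrite mulgA (hM (s * f)) // (hM f) // IH inc_left // mulgA.
  - by rewrite mulgA (hV (s * f)) // (hV f) // IH -[s * f / x]mulgA inc_left // mulgA.
(* The statement for [S], where [t] is 1, must be carried through vertices outside [S]; [t f] is the
   correction. *)
have hR2 f : R2 (t f * f^-1 * h f).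
  elim/(basis_ind hB): f => [|f x Bx IH|f x Bx IH].
  - rewrite h1 invg1 !mulg1 /t (asboolT (subgroup1 sS)); exact: (subgroup1 nR2.1).
  - have [_ qR2] := qP _ (incS f x).
    suff -> : t (f * x) * (f * x)^-1 * h (f * x) =
      ((inc f x)^-1 * q (inc f x)) * (t f * f^-1 * h f) ^ (q (inc f x)).
      exact: subgroupM nR2.1 qR2 (nR2.2 _ _ IH).
    rewrite hM // /inc; move: (q _) => c.
    by rewrite conjgE !invgM !invgK !mulgA mulgK mulgVK.
  - have [_ qR2] := qP _ (incS (f / x) x).
    have e : ((inc (f / x) x)^-1 * q (inc (f / x) x))^-1 * (t f * f^-1 * h f) =
      (t (f / x) * (f / x)^-1 * h (f / x)) ^ (q (inc (f / x) x)).
      rewrite hV // /inc; move: (q _) => c.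
      by rewrite mulgVK conjgE !invgM !invgK !mulgA !mulgVK.
    apply: (normal_conjV nR2 (y := q (inc (f / x) x))); rewrite -e.
    exact: subgroupM nR2.1 (subgroupV nR2.1 qR2) IH.
exists h; split=> // [x y Sx _|x Sx]; first exact: hS.
by have := hR2 x; rewrite /t asboolT // mul1g.
Qed.

Lemma commutators_meet : commutator R1 S `&` commutator R2 S `<=` commutator R1 R2.
Proof.
have [phi [phiR1 phiM phiR2]] := projective_lift.
have sS := nS.1; have nC := normal_commutator nR1 nR2.
have S1 : R1 `<=` S by apply: product_left nR2.1.
have S2 : R2 `<=` S by apply: product_right nR1.1.
pose K := R1 `&` R2.
have nK : normal_subgroup K.
  by split=> [|x y [h1 h2]]; [exact: subgroupI nR1.1 nR2.1|split; [exact: nR1.2|exact: nR2.2]].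
pose N := commutator R1 K.
have nN : normal_subgroup N := normal_commutator nR1 nK.
have NC : N `<=` commutator R1 R2.
  by apply: commutator_sub nC.1 _ => x y Rx [_ Ry]; apply: commutator_mem.
have phi1 : phi 1 = 1.
  have := phiM 1 1 (subgroup1 sS) (subgroup1 sS); rewrite mulg1 => /esym e.
  by apply: (mulgI (phi 1)); rewrite e mulg1.
have phiV x : S x -> phi x^-1 = (phi x)^-1.
  move=> Sx; apply: (mulgI (phi x)); rewrite -phiM //; last exact: subgroupV sS Sx.
  by rewrite !mulgV.
have phiC x y : S x -> S y -> phi [~ x, y] = [~ phi x, phi y].
  move=> Sx Sy; have Sx' := subgroupV sS Sx; have Sy' := subgroupV sS Sy.
  rewrite /commg /conjg !phiM ?phiV //; do ?apply: (subgroupM sS) => //.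
pose X := [set a | S a /\ N (a^-1 * phi a)].
have sX : subgroup X.
  apply/subgroupP; split=> [|x y [Sx Nx] [Sy Ny]].
    by split; [exact: subgroup1|rewrite phi1 invg1 mulg1; apply: subgroup1 nN.1].
  have Sy' := subgroupV sS Sy.
  split; first exact: subgroupM sS Sx Sy'.
  rewrite phiM // phiV //.
  suff -> : (x / y)^-1 * (phi x / phi y) = ((x^-1 * phi x) / (y^-1 * phi y)) ^ y^-1.
    exact: nN.2 (subgroupM nN.1 Nx (subgroupV nN.1 Ny)).
  by rewrite conjgE !invgM !invgK !mulgA mulgK.
(* On [R1] a commutator modulo [N] depends only on its arguments modulo [K], and [phi] moves
   elements of [R1] only by [K]. *)
have cong_left u k w : R1 u -> K k -> R1 w -> N ([~ u, w]^-1 * [~ u * k, w]).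
  move=> Ru Kk Rw; rewrite commMg.
  have -> : [~ u, w]^-1 * ([~ u, w] ^ k * [~ k, w]) = [~ [~ u, w], k] * [~ w, k]^-1.
    by rewrite mulgA -commgEl invgR.
  apply: (subgroupM nN.1); last by apply: subgroupV nN.1 _; apply: commutator_mem.
  apply: commutator_mem => //; rewrite /commg.
  exact: subgroupM nR1.1 (subgroupV nR1.1 Ru) (nR1.2 _ _ Ru).
have inX : commutator R1 R1 `<=` X.
  apply: commutator_sub sX _ => u v Ru Rv.
  have Su := S1 _ Ru; have Sv := S1 _ Rv.
  have Kf x : R1 x -> K (x^-1 * phi x).
    move=> Rx; split; last exact: phiR2 (S1 _ Rx).
    exact: subgroupM nR1.1 (subgroupV nR1.1 Rx) (phiR1 _ (S1 _ Rx)).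
  split; first by rewrite /commg; apply: (subgroupM sS) (subgroupV sS Su) (nS.2 _ _ Su).
  rewrite phiC //.
  have h1 := cong_left _ _ _ Ru (Kf _ Ru) (phiR1 _ Sv); rewrite mulVKg in h1.
  have h2 := cong_left _ _ _ Rv (Kf _ Rv) Ru; rewrite mulVKg in h2.
  have h3 := nN.2 _ [~ v, u]^-1 (subgroupV nN.1 h2).
  suff -> : [~ u, v]^-1 * [~ phi u, phi v] =
    ([~ v, u]^-1 * [~ phi v, u])^-1 ^ [~ v, u]^-1 * ([~ u, phi v]^-1 * [~ phi u, phi v]).
    exact: subgroupM nN.1 h3 h1.
  rewrite (invgR u v) (invgR u (phi v)); move: [~ v, u] [~ phi v, u] [~ phi u, phi v].
  by move=> x y z; rewrite conjgE !invgM !invgK !mulgA mulgK mulgVK.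
pose Y := [set a | S a /\ N (phi a)].
have sY : subgroup Y.
  apply/subgroupP; split=> [|x y [Sx Nx] [Sy Ny]].
    by split; [exact: subgroup1|rewrite phi1; apply: subgroup1 nN.1].
  have Sy' := subgroupV sS Sy.
  split; first exact: subgroupM sS Sx Sy'.
  by rewrite phiM // phiV //; apply: subgroupM nN.1 Nx (subgroupV nN.1 Ny).
(* On [R2] the values of [phi] lie in [R1] and, being congruent to their arguments modulo [R2], in
   [K]; so [phi] maps these commutators into [N]. *)
have inY : commutator R2 S `<=` Y.
  apply: commutator_sub sY _ => w s Rw Ss; have Sw := S2 _ Rw.
  split; first by rewrite /commg; apply: (subgroupM sS) (subgroupV sS Sw) (nS.2 _ _ Sw).
  rewrite phiC // -invgR; apply: subgroupV nN.1 _; apply: commutator_mem; first exact: phiR1.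
  split; first exact: phiR1.
  by have := subgroupM nR2.1 Rw (phiR2 _ Sw); rewrite mulVKg.
have split1 : commutator R1 S `<=` set_product (commutator R1 R1) (commutator R1 R2).
  have nP := normal_product (normal_commutator nR1 nR1) nC.
  apply: commutator_sub nP.1 _ => u _ Ru [x [y [Rx Ry ->]]].
  rewrite commgM; apply: (subgroupM nP.1).
    by apply: product_right (normal_commutator nR1 nR1).1 _ _; apply: commutator_mem.
  by apply: nP.2; apply: product_left nC.1 _ _; apply: commutator_mem.
move=> _ [/split1[a [b [aC bC ->]]] xC].
suff aN : commutator R1 R2 a by exact: subgroupM nC.1 aN bC.
have ba : commutator R2 S b.
  have nC2 := normal_commutator nR2 nS.
  apply: (commutator_sub nC2.1 _ bC) => x y Rx Ry.
  by rewrite -invgR; apply: subgroupV nC2.1 _; apply: commutator_mem => //; apply: S1.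
have aC2 : commutator R2 S a.
  rewrite -(mulgK b a); have sC2 := (normal_commutator nR2 nS).1.
  exact: subgroupM sC2 xC (subgroupV sC2 ba).
have [_ h1] := inX _ aC; have [_ h2] := inY _ aC2.
apply: NC; have := subgroupM nN.1 h2 (subgroupV nN.1 h1).
by rewrite invgM invgK mulVKg.
Qed.

End Lift.

(** * Subgroups of free abelian groups *)

Section SubgroupOfFreeAbelian.
Local Open Scope ring_scope.
Variables (A : groupType) (I : choiceType) (c : A -> I -> int).
Hypothesis cM : forall x y i, c (x * y)%g i = c x i + c y i.
Hypothesis c_fin : forall x, exists s : seq I, forall i, c x i != 0 -> i \in s.
Hypothesis c_inj : forall x, (forall i, c x i = 0) -> x = 1%g.

Lemma well_order_exists : exists le : rel I, [/\ total le, antisymmetric le, transitive le &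
  forall P : pred I, (exists i, P i) -> exists2 i, P i & forall j, P j -> le i j].
Proof.
have [le wo] := well_ordering_principle I; exists le.
have ex (P : pred I) : (exists i, P i) -> exists2 i, P i & forall j, P j -> le i j.
  move=> neP; have [i [[Pi lei] _]] := wo P neP.
  by exists i => // j Pj; apply: lei.
have tot : total le.
  move=> x y; have [|i] := ex (pred2 x y); first by exists x; rewrite /= eqxx.
  move=> /orP[/eqP-> /(_ y)|/eqP -> /(_ x)]; rewrite /= eqxx ?orbT => -> //.
  by rewrite orbT.
have refl x : le x x by case/orP: (tot x x).
have anti : antisymmetric le.
  move=> x y /andP[xy yx]; have [|i [[_ _] u]] := wo (pred2 x y); first by exists x; rewrite inE eqxx.
  rewrite -(u x); last by split=> [|z]; rewrite inE ?eqxx // => /orP[/eqP->|/eqP->].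
  by apply: u; split=> [|z]; rewrite inE ?eqxx ?orbT // => /orP[/eqP->|/eqP->].
split=> // y x z xy yz; have [|i] := ex (pred3 x y z); first by exists x; rewrite /= eqxx.
move=> /or3P[/eqP->|/eqP->|/eqP->] h.
- by apply: h; rewrite /= eqxx !orbT.
- have yx : le y x by apply: h; rewrite /= eqxx.
  by rewrite (anti x y) // xy yx.
- have zy : le z y by apply: h; rewrite /= eqxx orbT.
  by rewrite (anti z y) // zy yz.
Qed.

Lemma coef1 i : c 1%g i = 0.
Proof. by apply: (addrI (c 1%g i)); rewrite -cM mulg1 addr0. Qed.

Lemma coefV x i : c x^-1%g i = - c x i.
Proof. by apply/eqP; rewrite -addr_eq0 -cM mulVg coef1. Qed.

Lemma coef_ext x y : c x =1 c y -> x = y.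
Proof.
move=> xy; apply: divg1_eq; apply: c_inj => i.
by rewrite cM coefV xy subrr.
Qed.

Lemma coef_scale x (k : int) : exists y, forall i, c y i = k * c x i.
Proof.
have nat_scale (n : nat) i : c (x ^+ n)%g i = n%:Z * c x i.
  elim: n => [|n IH]; first by rewrite expg0 coef1 mul0r.
  by rewrite expgS cM IH intS mulrDl mul1r.
case: k => n; first by exists (x ^+ n)%g.
exists (x ^+ n.+1)^-1%g => i.
by rewrite coefV nat_scale NegzE mulNr.
Qed.

Variable le : rel I.
Hypotheses (tot : total le) (anti : antisymmetric le) (tr : transitive le).
Hypothesis wf : forall P : pred I, (exists i, P i) -> exists2 i, P i & forall j, P j -> le i j.

Definition supported (i : I) : set A := [set x | forall j, c x j != 0 -> le j i].

Lemma lead x : x <> 1%g -> exists2 i, c x i != 0 & supported i x.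
Proof.
move=> x1; have [s hs] := c_fin x.
have [i0 ci0] : exists i, c x i != 0.
  apply: contrapT => h; apply: x1; apply: c_inj => i; apply/eqP.
  by apply: contra_notT h => ci; exists i.
pose s' := [seq i <- s | c x i != 0].
have mem_s' i : (i \in s') = (c x i != 0).
  by rewrite mem_filter; case: eqP => //= /eqP/hs ->.
have : exists2 i, i \in s' & {in s', forall j, le j i}.
  have : s' != [::] by apply/eqP => e; have := mem_s' i0; rewrite e ci0.
  elim: (s') => // i r IH _; have refl j : le j j by case/orP: (tot j j).
  have [->|/IH[j jr hj]] := eqVneq r [::].
    by exists i; rewrite ?mem_head // => k; rewrite inE => /eqP ->.
  case/orP: (tot i j) => ij.
    exists j; first by rewrite inE jr orbT.
    by move=> k; rewrite inE => /predU1P[->//|/hj].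
  exists i; first by rewrite mem_head.
  by move=> k; rewrite inE => /predU1P[->//|/hj kj]; apply: tr kj ij.
move=> [i]; rewrite mem_s' => ci hi; exists i => // j cj.
by apply: hi; rewrite mem_s'.
Qed.

Definition leading (i : I) : bool := `[< exists2 x, supported i x & c x i != 0 >].

Lemma leading_generator i : leading i -> exists p, [/\ supported i p, c p i != 0 &
  forall x, supported i x -> exists k, c x i = k * c p i].
Proof.
move=> /asboolP[x0 sx0 cx0].
pose P n := `[< exists x, [/\ supported i x, c x i != 0 & `|c x i|%N = n] >].
have exP : exists n, P n by exists `|c x0 i|%N; apply/asboolP; exists x0.
case: (ex_minnP exP) => _ /asboolP[p [sp cp <-]] min.
exists p; split=> // x sx; exists (c x i %/ c p i)%Z.
have [y cy] := coef_scale p (- (c x i %/ c p i)%Z).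
have cxy : c (x * y)%g i = (c x i %% c p i)%Z by rewrite cM cy mulNr /modz.
have [e|ne] := eqVneq (c (x * y)%g i) 0.
  by have /dvdz_mod0P := etrans (esym cxy) e; rewrite dvdz_eq eq_sym => /eqP.
have : (`|c p i| <= `|c (x * y)%g i|)%N.
  apply: min; apply/asboolP; exists (x * y)%g; split=> // j.
  rewrite cM cy; have [->|/sx//] := eqVneq (c x j) 0; rewrite add0r mulf_eq0 negb_or => /andP[_].
  exact: sp.
rewrite cxy => h; exfalso; have := ltz_mod (c x i) cp; have := modz_ge0 (c x i) cp.
by move: h; clear; lia.
Qed.

(** For each leading index [i] choose [p i] whose coefficient at [i] generates the ideal of all
    coefficients at [i] of elements supported up to [i]. Independence is seen at the highest index
    of a relation. *)
Theorem free_abelian_of_coefficients : free_abelian_group A.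
Proof.
have [p pP] : exists p : I -> A, forall i, leading i -> [/\ supported i (p i), c (p i) i != 0 &
    forall x, supported i x -> exists k, c x i = k * c (p i) i].
  suff : forall i, exists p, leading i -> [/\ supported i p, c p i != 0 &
    forall x, supported i x -> exists k, c x i = k * c p i] by move=> H; have [q qP] := choice H; exists q.
  move=> i; have [/leading_generator[q qP]|_] := boolP (leading i); first by exists q.
  by exists 1%g.
pose X : choiceType := {i : I | leading i}.
pose Psi (D : {freeg X}) j : int := fglift (fun z : X => c (p (val z)) j : int^o) D.
have PsiB D D' j : Psi (D - D') j = Psi D j - Psi D' j by exact: (@lift_is_additive int X int^o (fun z => c (p (val z)) j) D D').
have Psi0 j : Psi 0 j = 0 by have := PsiB 0 0 j; rewrite !subrr.
have PsiD D D' j : Psi (D + D') j = Psi D j + Psi D' j.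
  by rewrite -[D']opprK PsiB -sub0r PsiB Psi0 sub0r opprK opprB subr0.
have Psi_sum (s : seq X) (f : X -> {freeg X}) j :
    Psi (\sum_(z <- s) f z) j = \sum_(z <- s) Psi (f z) j.
  by elim: s => [|z s IH]; rewrite ?big_nil // !big_cons PsiD IH.
have PsiU k (z : X) j : Psi << k *g z >> j = k * c (p (val z)) j by exact: (@liftU int int^o X (fun z => c (p (val z)) j) k z).
have surj D : exists x, forall j, c x j = Psi D j.
  rewrite -(freeg_sumE D); elim: (dom D) => [|z s [x hx]].
    by exists 1%g => j; rewrite coef1 big_nil Psi0.
  have [y hy] := coef_scale (p (val z)) (coeff z D).
  by exists (y * x)%g => j; rewrite cM hx hy big_cons PsiD PsiU.
have Psi_inj D : (forall j, Psi D j = 0) -> D = 0.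
  move=> D0; apply/eqP; rewrite -dom_eq0; apply/eqP; case def_s : (dom D) => // [z0 s0].
  have [z zD zmax] : exists2 z, z \in dom D & {in dom D, forall y, le (val y) (val z)}.
    rewrite def_s; elim: (s0) z0 {def_s} => [|y s IH] z0.
      by exists z0; rewrite ?mem_head // => y; rewrite inE => /eqP ->; case/orP: (tot (val z0) (val z0)).
    have [z zs hz] := IH y; case/orP: (tot (val z0) (val z)) => zz.
      exists z; first by rewrite inE zs orbT.
      by move=> x; rewrite inE => /predU1P[->//|/hz].
    exists z0; first exact: mem_head.
    move=> x; rewrite inE => /predU1P[->|/hz xz]; first by case/orP: (tot (val z0) (val z0)).
    exact: tr xz zz.
  have : Psi D (val z) = coeff z D * c (p (val z)) (val z).
    rewrite -[in LHS](freeg_sumE D) Psi_sum (bigD1_seq z) ?uniq_dom //=.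
    rewrite PsiU big1_seq ?addr0 // => y /andP[yz yD]; rewrite PsiU.
    have [sy _ _] := pP _ (valP y); suff /eqP -> : c (p (val y)) (val z) == 0 by rewrite mulr0.
    apply: contraR yz => /sy zy; apply/eqP/val_inj/anti.
    by rewrite zy (zmax _ yD).
  rewrite D0 => /esym/eqP; rewrite mulf_eq0 => /orP[/eqP e|].
    by move: zD; rewrite mem_dom e eqxx.
  by have [_ /negbTE ->] := pP _ (valP z).
have span x : exists D, forall j, c x j = Psi D j.
  apply: contrapT => bad.
  (* Among elements outside the span take one with the least leading index; subtracting a multiple
     of [p i0] kills that leading coefficient, against minimality. *)
  pose good y := exists D, forall j, c y j = Psi D j.
  pose P i := `[< exists y, [/\ ~ good y, c y i != 0 & supported i y] >].
  have lead_bad y : ~ good y -> exists i, P i /\ c y i != 0 /\ supported i y.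
    move=> by_; have [|i ci si] := @lead y.
      by move=> y1; apply: by_; exists 0 => j; rewrite y1 coef1 Psi0.
    by exists i; split=> //; apply/asboolP; exists y.
  have [|i0 /asboolP[y [by_ cy sy]] min] := wf (P := P).
    by have [i [Pi _]] := lead_bad _ bad; exists i.
  have li0 : leading i0 by apply/asboolP; exists y.
  have [sp cp gp] := pP _ li0; have [k ck] := gp _ sy.
  have [w cw] := coef_scale (p i0) (- k).
  have cyw j : c (y * w)%g j = c y j - k * c (p i0) j by rewrite cM cw mulNr.
  have nyw : ~ good (y * w)%g.
    move=> [D hD]; apply: by_; exists (D + << k *g (Sub i0 li0 : X) >>) => j.
    by rewrite PsiD PsiU -hD cyw SubK subrK.
  have [i [Pi [ci si]]] := lead_bad _ nyw.
  have ii0 : le i i0.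
    have [e|/sy//] := eqVneq (c y i) 0; move: ci; rewrite cyw e add0r oppr_eq0 mulf_eq0 negb_or.
    by move=> /andP[_ /sp].
  have ei : i = i0 by apply: anti; rewrite ii0 min.
  by move: ci; rewrite ei cyw ck subrr eqxx.
have [phi phiP] := choice span.
have phi_uniq x D : (forall j, c x j = Psi D j) -> phi x = D.
  move=> h; apply/eqP; rewrite -subr_eq0; apply/eqP/Psi_inj => j.
  by rewrite PsiB -phiP h subrr.
exists X, phi; split; last first.
  by move=> x y; apply: phi_uniq => j; rewrite cM PsiD -!phiP.
have [psi psiP] := choice surj.
exists psi => [x|D]; last by apply: phi_uniq.
by apply: coef_ext => j; rewrite psiP -phiP.
Qed.

End SubgroupOfFreeAbelian.

(** * Embedding the quotient into a free abelian group *)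

Lemma quotient_morphism (G : groupType) (N : set G) (nN : normal_subgroup N)
    (V : zmodType) (f : G -> V) :
  (forall x y, f (x * y) = (f x + f y)%R) -> (forall x, N x -> f x = 0%R) ->
  forall u v : quotient nN, f (repr (u * v)) = (f (repr u) + f (repr v))%R.
Proof.
move=> fM fN u v; rewrite -fM; set x := repr u * repr v.
have := fN _ (repr_pi nN x); rewrite fM => /eqP; rewrite addr_eq0 => /eqP e.
have f1 : f 1 = 0%R by apply: (addrI (f 1)); rewrite -fM mulg1 addr0.
have fV y : f y^-1 = (- f y)%R by apply/eqP; rewrite -addr_eq0 -fM mulVg f1.
by move: e; rewrite fV => /oppr_inj.
Qed.

Theorem mainTheorem3 (F : groupType) (hF : free_group F) (r1 r2 : F) :
  let R1 := normal_closure r1 in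
  let R2 := normal_closure r2 in
  let nR1 : normal_subgroup R1 := normal_normal_closure r1 in
  let nR2 : normal_subgroup R2 := normal_normal_closure r2 in
  free_abelian_group
    (@subquotient F (R1 `&` R2) (commutator R1 R2)
       (subgroupI (proj1 nR1) (proj1 nR2)) (normal_commutator nR1 nR2)
       (commutator_subI nR1 nR2)).
Proof.
move=> R1 R2 nR1 nR2; have [B hB] := hF.
pose S := set_product R1 R2; have nS : normal_subgroup S := normal_product nR1 nR2.
have R1S : R1 `<=` S by apply: product_left nR2.1.
have R2S : R2 `<=` S by apply: product_right nR1.1.
have [lam1 [lam1M lam1P]] := relation_hom hB nS R1S.
have [lam2 [lam2M lam2P]] := relation_hom hB nS R2S.
have sub1 : commutator R1 R2 `<=` commutator R1 S.
  by apply: commutator_sub (normal_commutator nR1 nS).1 _ => x y Rx Ry;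
    apply: commutator_mem => //; apply: R2S.
have sub2 : commutator R1 R2 `<=` commutator R2 S.
  have nC2 := normal_commutator nR2 nS.
  apply: commutator_sub nC2.1 _ => x y Rx Ry; rewrite -invgR.
  by apply: subgroupV nC2.1 _; apply: commutator_mem => //; apply: R1S.
set nN := normal_commutator nR1 nR2; set sK := subgroupI _ _.
pose lam (b : bool) (x : subgroup_type sK) := if b then lam1 (val x) else lam2 (val x).
have valK (x : subgroup_type sK) : R1 (val x) /\ R2 (val x) by case: x => x xK; apply: set_mem xK.
have lamM b x y : lam b (x * y) = (lam b x + lam b y)%R.
  have [[x1 x2] [y1 y2]] := (valK x, valK y).
  by case: b; [apply: lam1M|apply: lam2M].
have lamN b x : commutator R1 R2 (val x) -> lam b x = 0%R.
  have [x1 x2] := valK x.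
  by case: b => h; [apply: (lam1P _ x1).2 (sub1 _ h)|apply: (lam2P _ x2).2 (sub2 _ h)].
(* The boolean makes the index set a disjoint union of two copies, one for the cosets belonging to
   each relator. *)
have [le [tot anti tr wf]] := well_order_exists (bool * set F)%type.
pose c (u : quotient (normal_in_subgroup_type sK nN)) (i : bool * set F) :=
  coeff i.2 (lam i.1 (repr u)).
apply: (free_abelian_of_coefficients (c := c) _ _ _ tot anti tr wf).
- move=> u v i; rewrite /c -coeffD; congr coeff.
  exact: (quotient_morphism (lamM i.1) (lamN i.1)).
- move=> u; exists ([seq (true, z) | z <- dom (lam true (repr u))] ++
    [seq (false, z) | z <- dom (lam false (repr u))]).
  by move=> [b z]; rewrite /c /= -mem_dom mem_cat => zd; case: b zd => zd;
    rewrite (map_f (pair _) zd) ?orbT.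
move=> u u0; have [x1 x2] := valK (repr u).
have lam0 b : lam b (repr u) = 0%R.
  by apply/eqP/freeg_eqP => z; rewrite coeff0; apply: (u0 (b, z)).
have uN : commutator R1 R2 (val (repr u)).
  apply: (commutators_meet hB nR1 nR2); split.
    by apply/(lam1P _ x1); apply: (lam0 true).
  by apply/(lam2P _ x2); apply: (lam0 false).
rewrite -[u]reprK; apply/(eq_pi (normal_in_subgroup_type sK nN)).
rewrite /= mulg1; apply: subgroupV nN.1 _; exact: uN.
Qed.
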